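(* Let $m,n,r$ be positive integers with $r\le\min\{m,n\}$. Let $\mathcal{M}_r\subset\mathbb{H}^{m\times n}$ be the set of quaternion matrices of rank $r$, $\mathcal{M}_*\subset\mathbb{H}^{m\times n}$ the set of quaternion matrices with zero real part, and $\mathcal{M}_{r*}=\mathcal{M}_r\cap\mathcal{M}_*$ (each identified with its image in $\mathbb{R}^{4m\times4n}$ under the real representation). Let $\pi_1,\pi_2,\pi$ be the projections onto $\mathcal{M}_r$, $\mathcal{M}_*$, $\mathcal{M}_{r*}$, respectively. Suppose that $\mathbf{B}\in\mathcal{M}_{r*}$ is a non-tangential intersection point of $\mathcal{M}_r$ and $\mathcal{M}_*$. Then for any given $\epsilon>0$ and $1>c>\sigma(\mathbf{B})$ there exists $s>0$ such that for any $\mathbf{A}$ in the ball $\mathcal{B}(\mathbf{B},s)$ of radius $s$ about $\mathbf{B}$, the sequence $\{\mathbf{X}_k\}_{k=0}^\infty$ generated by the alternating projections algorithm $$\mathbf{X}_0=\mathbf{A},\qquad \mathbf{Y}_{k+1}=\pi_1(\mathbf{X}_k),\qquad \mathbf{X}_{k+1}=\pi_2(\mathbf{Y}_{k+1})$$ satisfies: (1) the sequence converges to a point $\mathbf{X}_\infty\in\mathcal{M}_r\cap\mathcal{M}_*$; (2) $\|\mathbf{X}_\infty-\pi(\mathbf{A})\|\le\epsilon\,\|\mathbf{A}-\pi(\mathbf{A})\|$; (3) $\|\mathbf{X}_\infty-\mathbf{X}_k\|\le \mathrm{const}\cdot c^k\,\|\mathbf{A}-\pi(\mathbf{A})\|$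 for all $k$, where $\mathrm{const}$ is a constant independent of $k$.
   Context: $\mathbb{H}$ is the real quaternion algebra; $\mathbf{A}\in\mathbb{H}^{m\times n}$ is written $\mathbf{A}=A_0+A_1\mathbf{i}+A_2\mathbf{j}+A_3\mathbf{k}$ with real $m\times n$ matrices $A_i$, and $A_0$ is its real part. The rank of a quaternion matrix is the maximum number of right linearly independent columns. The real representation is the injective real-linear map $$\phi(\mathbf{A})=\begin{pmatrix} A_0 & -A_1 & -A_2 & -A_3 \\ A_1 & A_0 & -A_3 & A_2 \\ A_2 & A_3 & A_0 & -A_1 \\ A_3 & -A_2 & A_1 & A_0 \end{pmatrix}\in\mathbb{R}^{4m\times4n};$$ under it $\mathcal{M}_r$ corresponds to the matrices of this form of real rank $4r$, and $\mathcal{M}_*$ to those with $A_0=0$. Norms and inner products are Frobenius. Projections: $\pi_1(\mathbf{X})$, $\pi_2(\mathbf{X})$, $\pi(\mathbf{X})$ denote an arbitrary closest point to $\mathbf{X}$ on $\mathcal{M}_r$, $\mathcal{M}_*$, $\mathcal{M}_{r*}$ respectively. Explicitly, $\pi_1(\mathbf{X})=\sum_{i=1}^r\sigma_i\mathbf{u}_i\mathbf{v}_i^*$, where $\mathbf{X}=\mathbf{U}\boldsymbol{\Sigma}\mathbf{V}^*$ is a quaternion singular value decomposition ($\mathbf{U},\mathbf{V}$ unitary quaternion matrices with columns $\mathbf{u}_i,\mathbf{v}_i$; $\sigma_1\ge\sigma_2\ge\cdots\ge0$ the real singular values), and $\pi_2(X_0+X_1\mathbf{i}+X_2\mathbf{j}+X_3\mathbf{k})=X_1\mathbf{i}+X_2\mathbf{j}+X_3\mathbf{k}$.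 Angle and non-tangentiality: let $\mathcal{M}_1,\mathcal{M}_2$ be manifolds in a Euclidean space and $A\in\mathcal{M}_1\cap\mathcal{M}_2$. For $\xi>0$, $j=1,2$ set $$F_j^{\xi}=\{B_j\in\mathcal{M}_j\setminus\{A\}:\ \|B_j-A\|\le\xi,\ B_j-A\perp T_{\mathcal{M}_1\cap\mathcal{M}_2}(A)\},$$ where $T_{\mathcal{M}_1\cap\mathcal{M}_2}(A)$ is the tangent space at $A$ of the intersection. If $F_1^\xi,F_2^\xi\ne\emptyset$ for all $\xi>0$, set $$\sigma(A)=\lim_{\xi\to0}\ \sup_{B_1\in F_1^\xi,\,B_2\in F_2^\xi}\frac{\langle B_1-A,B_2-A\rangle}{\|B_1-A\|\,\|B_2-A\|},\qquad \alpha(A)=\cos^{-1}(\sigma(A)).$$ Points where the angle $\alpha(A)$ is defined are non-trivial intersection points; such a point is non-tangential if $\alpha(A)>0$. In the theorem, $\sigma(\mathbf{B})$ is this quantity for $\mathcal{M}_1=\mathcal{M}_r$, $\mathcal{M}_2=\mathcal{M}_*$. *)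

(* Defs.v *)
From HB Require Import structures.
From mathcomp Require Import all_boot all_order all_algebra.
From mathcomp Require Import ring.
From mathcomp Require Import all_classical all_reals all_analysis.

Set Implicit Arguments.
Unset Strict Implicit.
Unset Printing Implicit Defensive.

Import Order.TTheory GRing.Theory Num.Theory.
Import numFieldNormedType.Exports.

Local Open Scope classical_set_scope.
Local Open Scope ring_scope.

(** * Quaternions *)

(* [Quat a b c d] is a + b i + c j + d k. *)
Record quat (R : Type) := Quat { qre : R; qi : R; qj : R; qk : R }.

Section QuatRing.
Variable R : comNzRingType.
Implicit Types x y z : quat R.

Definition quat_to_prod x := (qre x, qi x, qj x, qk x).
Definition quat_of_prod (p : R * R * R * R) :=
  Quat p.1.1.1 p.1.1.2 p.1.2 p.2.

Lemma quat_to_prodK : cancel quat_to_prod quat_of_prod.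
Proof. by case. Qed.

HB.instance Definition _ := Choice.copy (quat R) (can_type quat_to_prodK).

Definition qzero : quat R := Quat 0 0 0 0.
Definition qone : quat R := Quat 1 0 0 0.
Definition qopp x := Quat (- qre x) (- qi x) (- qj x) (- qk x).
Definition qadd x y :=
  Quat (qre x + qre y) (qi x + qi y) (qj x + qj y) (qk x + qk y).
Definition qmul x y :=
  Quat (qre x * qre y - qi x * qi y - qj x * qj y - qk x * qk y)
       (qre x * qi y + qi x * qre y + qj x * qk y - qk x * qj y)
       (qre x * qj y - qi x * qk y + qj x * qre y + qk x * qi y)
       (qre x * qk y + qi x * qj y - qj x * qi y + qk x * qre y).

Lemma qaddA : associative qadd.
Proof. by case=> ? ? ? ? [? ? ? ?] [? ? ? ?]; congr Quat; exact: addrA. Qed.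

Lemma qaddC : commutative qadd.
Proof. by case=> ? ? ? ? [? ? ? ?]; congr Quat; exact: addrC. Qed.

Lemma qadd0 : left_id qzero qadd.
Proof. by case=> ? ? ? ?; congr Quat; exact: add0r. Qed.

Lemma qaddN : left_inverse qzero qopp qadd.
Proof. by case=> ? ? ? ?; congr Quat; exact: addNr. Qed.

HB.instance Definition _ :=
  GRing.isZmodule.Build (quat R) qaddA qaddC qadd0 qaddN.

Lemma qmulA : associative qmul.
Proof.
by case=> ? ? ? ? [? ? ? ?] [? ? ? ?]; rewrite /qmul /=; congr Quat; ring.
Qed.

Lemma qmul1 : left_id qone qmul.
Proof. by case=> ? ? ? ?; rewrite /qmul /=; congr Quat; ring. Qed.

Lemma qmulr1 : right_id qone qmul.
Proof. by case=> ? ? ? ?; rewrite /qmul /=; congr Quat; ring. Qed.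

Lemma qmulDl : left_distributive qmul qadd.
Proof.
by case=> ? ? ? ? [? ? ? ?] [? ? ? ?]; rewrite /qmul /qadd /=; congr Quat; ring.
Qed.

Lemma qmulDr : right_distributive qmul qadd.
Proof.
by case=> ? ? ? ? [? ? ? ?] [? ? ? ?]; rewrite /qmul /qadd /=; congr Quat; ring.
Qed.

Lemma qone_neq0 : qone != 0.
Proof. by apply/eqP => -[] /eqP; rewrite oner_eq0. Qed.

HB.instance Definition _ :=
  GRing.Zmodule_isNzRing.Build (quat R)
    qmulA qmul1 qmulr1 qmulDl qmulDr qone_neq0.

End QuatRing.

(** * Quaternion matrices *)

Section QuatMatrix.
Context {R : realType} {m n : nat}.
Implicit Types A X Y Z : 'M[quat R]_(m, n).

Definition realrep A : 'M[R]_(m + m + (m + m), n + n + (n + n)) :=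
  let A0 := map_mx (@qre R) A in let A1 := map_mx (@qi R) A in
  let A2 := map_mx (@qj R) A in let A3 := map_mx (@qk R) A in
  block_mx (block_mx A0 (- A1) A1 A0) (block_mx (- A2) (- A3) (- A3) A2)
           (block_mx A2 A3 A3 (- A2)) (block_mx A0 (- A1) A1 A0).

(* The columns of A with index in J are right linearly independent. *)
Definition right_free A (J : {set 'I_n}) : Prop :=
  forall a : 'I_n -> quat R,
    (forall i, \sum_(j in J) A i j * a j = 0) -> forall j, j \in J -> a j = 0.

Definition qrank A : nat := (\max_(J : {set 'I_n} | `[< right_free A J >]) #|J|)%N.

Definition qnorm A : R :=
  Num.sqrt (\sum_i \sum_j (qre (A i j) ^+ 2 + qi (A i j) ^+ 2
                           + qj (A i j) ^+ 2 + qk (A i j) ^+ 2)).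

Definition rank_mfd (r : nat) : set 'M[quat R]_(m, n) := [set A | qrank A = r].

Definition pure_mfd : set 'M[quat R]_(m, n) :=
  [set A | map_mx (@qre R) A = 0].

Definition pure_rank_mfd (r : nat) : set 'M[quat R]_(m, n) :=
  rank_mfd r `&` pure_mfd.

Definition closest (M : set 'M[quat R]_(m, n)) X Y : Prop :=
  M Y /\ forall Z, M Z -> qnorm (X - Y) <= qnorm (X - Z).

(* [p] selects an arbitrary closest point wherever one exists.  Since the set of
   matrices of rank r is not closed, nothing is required of [p X] when the
   distance from X to M is not attained. *)
Definition is_projection (M : set 'M[quat R]_(m, n))
    (p : 'M[quat R]_(m, n) -> 'M[quat R]_(m, n)) : Prop :=
  forall X, (exists Y, closest M X Y) -> closest M X (p X).

End QuatMatrix.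

(** * Manifolds, tangent spaces and angles in the Euclidean space 'M[R]_(p, q) *)

Section Angle.
Context {R : realType} {p q : nat}.
Notation E := 'M[R]_(p, q).

Definition frob_dot (A B : E) : R := \sum_i \sum_j A i j * B i j.
Definition frob (A : E) : R := Num.sqrt (frob_dot A A).

Fixpoint of_class (k : nat) (d : nat) (U : set 'rV[R]_d) (f : 'rV[R]_d -> E)
    : Prop :=
  if k is k'.+1 then
    (forall x, U x -> differentiable f x) /\ (forall v, of_class k' U ('D_v f))
  else forall x, U x -> {for x, continuous f}.

(* Near A, the set M is the bijective image, with continuous inverse g, of the
   open set U under the C^2 immersion f, and f x = A.  Without continuity of g
   the image of f could accumulate on itself at A. *)
Definition chart_at (M : set E) (A : E) (d : nat) (U : set 'rV[R]_d)
    (f : 'rV[R]_d -> E) (x : 'rV[R]_d) : Prop :=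
  [/\ open U, U x, f x = A, of_class 2 U f &
      (forall y, U y -> injective ('d f y))] /\
  exists (W : set E) (g : E -> 'rV[R]_d),
    [/\ open W, f @` U = M `&` W, (forall y, U y -> g (f y) = y) &
        {within M `&` W, continuous g}].

Definition manifold_at (M : set E) (A : E) : Prop :=
  exists d (U : set 'rV[R]_d) f x, chart_at M A U f x.

(* The range of the differential does not depend on the chart; this is the
   empty set when M is not a manifold near A. *)
Definition tangent_space (M : set E) (A : E) : set E :=
  [set w | exists d (U : set 'rV[R]_d) f x,
             chart_at M A U f x /\ range ('d f x) w].

(* With M := M1, M2 this is F_1^xi, F_2^xi. *)
Definition angle_set (M1 M2 : set E) (A : E) (M : set E) (xi : R) : set E :=
  [set B | [/\ M B, B <> A, frob (B - A) <= xi &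
     forall w, tangent_space (M1 `&` M2) A w -> frob_dot (B - A) w = 0]].

Definition sigma (M1 M2 : set E) (A : E) : R :=
  lim ((fun xi : R =>
    sup [set z | exists2 B1, angle_set M1 M2 A M1 xi B1 &
                 exists2 B2, angle_set M1 M2 A M2 xi B2 &
                 z = frob_dot (B1 - A) (B2 - A) / (frob (B1 - A) * frob (B2 - A))])
    @ 0^'+).

Definition alpha (M1 M2 : set E) (A : E) : R := acos (sigma M1 M2 A).

(* The angle at A is defined: the tangent space of the intersection at A makes
   sense, and the sets F_j^xi are nonempty. *)
Definition nontrivial_point (M1 M2 : set E) (A : E) : Prop :=
  [/\ (M1 `&` M2) A, manifold_at (M1 `&` M2) A &
      forall xi, 0 < xi ->
        angle_set M1 M2 A M1 xi !=set0 /\ angle_set M1 M2 A M2 xi !=set0].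

Definition nontangential (M1 M2 : set E) (A : E) : Prop :=
  nontrivial_point M1 M2 A /\ 0 < alpha M1 M2 A.

End Angle.

(* Main.v *)
From HB Require Import structures.
Require Import Defs.
From mathcomp Require Import all_boot all_order all_algebra.
From mathcomp Require Import ring lra.
From mathcomp Require Import all_classical all_reals all_analysis.
Import Order.TTheory GRing.Theory Num.Theory.
Import numFieldNormedType.Exports.
Local Open Scope classical_set_scope.
Local Open Scope ring_scope.

Set Implicit Arguments.
Unset Strict Implicit.
Unset Printing Implicit Defensive.

(** The rank r matrices M1 and the intersection M = M1 `&` L with the space L of pure
    matrices are strictly differentiable at B: near B their chords are, up to a small
    relative error d, in the fixed tangent spaces at B, whose projectors are P1 and P,
    and every small tangent step stays in the set up to that error. Hence, for z in M
    closest to X, the residual X - z is almost orthogonal to the range of P and the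
    closest point of X in M1 is z + P1 (X - z), both up to d |X - z|. Since sigma(B) < c
    bounds the cosine between the ranges of P1 and PL modulo that of P, one alternation
    multiplies the distance to M by at most c; it moves X by a comparable amount, whence
    geometric convergence, and its component along P is at most d times that distance.
    Summing, the limit and pi(A), two points of M, differ along P by O(d) |A - pi(A)|,
    hence differ by O(d) |A - pi(A)|. The strict differentiability of M1 comes from
    factoring a matrix through r of its columns, that of M from the given charts by the
    mean value theorem. *)

(** All estimates are taken at the single point B with fixed projectors, and curvature is absorbed
    in d by shrinking the ball. The nearest-point maps, being arbitrary selections, enter only
    through minimality of the distance. The obstacle is that [sigma] tests only points of M1 whose
    offset from B is exactly orthogonal to the tangent space of M, while the contraction concerns
    tangent vectors. An approximate tangent step is not admissible there, so [tangent_at_onto]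
    produces y in M1 with P1 (y - B) prescribed exactly, by minimising over a compact piece of M1.
    The identities P P1 = P and P PL = P, which hold because charts of M give curves in M1 and in L,
    then make the offset orthogonal to the range of P. Quaternion rank is handled over the reals:
    right independence of columns amounts to a left inverse of the real representation, and
    perturbing it is a matter of norms. *)

(** * The Frobenius inner product, completeness and attained minima *)

Section Frobenius.
Context {R : realType} {p q : nat}.
Notation E := 'M[R]_(p, q).
Implicit Types (u v w : E) (a : R).

Lemma frob_dotC u v : frob_dot u v = frob_dot v u.
Proof. by apply: eq_bigr => i _; apply: eq_bigr => j _; rewrite mulrC. Qed.

Lemma frob_dotDl u v w : frob_dot (u + v) w = frob_dot u w + frob_dot v w.
Proof.
rewrite -big_split; apply: eq_bigr => i _ /=; rewrite -big_split.
by apply: eq_bigr => j _ /=; rewrite mxE mulrDl.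
Qed.

Lemma frob_dotZl a u w : frob_dot (a *: u) w = a * frob_dot u w.
Proof.
rewrite mulr_sumr; apply: eq_bigr => i _; rewrite mulr_sumr.
by apply: eq_bigr => j _; rewrite mxE mulrA.
Qed.

Lemma frob_dotDr u v w : frob_dot w (u + v) = frob_dot w u + frob_dot w v.
Proof. by rewrite frob_dotC frob_dotDl !(frob_dotC w). Qed.

Lemma frob_dotZr a u w : frob_dot w (a *: u) = a * frob_dot w u.
Proof. by rewrite frob_dotC frob_dotZl (frob_dotC w). Qed.

Lemma frob_dotNl u w : frob_dot (- u) w = - frob_dot u w.
Proof. by rewrite -scaleN1r frob_dotZl mulN1r. Qed.

Lemma frob_dotNr u w : frob_dot w (- u) = - frob_dot w u.
Proof. by rewrite -scaleN1r frob_dotZr mulN1r. Qed.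

Lemma frob_dot0l w : frob_dot 0 w = 0.
Proof. by rewrite -(scale0r 0) frob_dotZl mul0r. Qed.

Lemma frob_dotE u v : frob_dot u v = \sum_ij u ij.1 ij.2 * v ij.1 ij.2.
Proof. by rewrite /frob_dot pair_big. Qed.

Lemma frob_dot_ge0 u : 0 <= frob_dot u u.
Proof. by rewrite frob_dotE; apply: sumr_ge0 => i _; rewrite -expr2 sqr_ge0. Qed.

Lemma sqr_frob u : frob u ^+ 2 = frob_dot u u.
Proof. by rewrite sqr_sqrtr ?frob_dot_ge0. Qed.

Lemma frob_ge0 u : 0 <= frob u.
Proof. exact: sqrtr_ge0. Qed.
Local Hint Resolve frob_ge0 : core.

Lemma frob0 : frob (0 : E) = 0.
Proof. by rewrite /frob frob_dot0l sqrtr0. Qed.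

Lemma frob_eq0 u : frob u = 0 -> u = 0.
Proof.
move=> u0; apply/matrixP => i j; rewrite mxE.
have /eqP : frob_dot u u = 0 by rewrite -sqr_frob u0 expr0n.
rewrite frob_dotE psumr_eq0; last by move=> k _; rewrite -expr2 sqr_ge0.
by move=> /allP/(_ (i, j)); rewrite mem_index_enum => /(_ isT); rewrite mulf_eq0 orbb => /eqP.
Qed.

Lemma frobZ a u : frob (a *: u) = `|a| * frob u.
Proof. by rewrite /frob frob_dotZl frob_dotZr mulrA -expr2 sqrtrM ?sqr_ge0 // sqrtr_sqr. Qed.

Lemma frobN u : frob (- u) = frob u.
Proof. by rewrite -scaleN1r frobZ normrN1 mul1r. Qed.

Lemma frob_distC u v : frob (u - v) = frob (v - u).
Proof. by rewrite -frobN opprB. Qed.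

Lemma frob_dot_le u v : frob_dot u v <= frob u * frob v.
Proof.
have [/frob_eq0 ->|v0] := eqVneq (frob v) 0; first by rewrite frob0 mulr0 frob_dotC frob_dot0l.
have [/frob_eq0 ->|u0] := eqVneq (frob u) 0; first by rewrite frob0 mul0r frob_dot0l.
have vp : 0 < frob v by rewrite lt0r v0 frob_ge0.
have up : 0 < frob u by rewrite lt0r u0 frob_ge0.
have := frob_dot_ge0 (frob v *: u - frob u *: v).
rewrite !(frob_dotDl, frob_dotDr, frob_dotNl, frob_dotNr, frob_dotZl, frob_dotZr).
rewrite -!sqr_frob (frob_dotC v u) => h.
rewrite -(ler_pM2l (mulr_gt0 up vp)); nra.
Qed.

Lemma frob_triangle u v : frob (u + v) <= frob u + frob v.
Proof.
rewrite -(@ler_pXn2r _ 2) ?nnegrE ?addr_ge0 // sqr_frob frob_dotDl !frob_dotDr.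
by rewrite -!sqr_frob (frob_dotC v u); have := frob_dot_le u v; nra.
Qed.

Lemma frob_triangleB u v w : frob (u - w) <= frob (u - v) + frob (v - w).
Proof. by rewrite -{1}(subrK v u) -addrA frob_triangle. Qed.

Lemma frob_sub_le u v : frob u - frob v <= frob (u - v).
Proof. by rewrite lerBlDr -{1}(subrK v u) frob_triangle. Qed.

Lemma frob_dot_abs u v : `|frob_dot u v| <= frob u * frob v.
Proof.
by rewrite ler_norml lerNl -frob_dotNl frob_dot_le -(frobN u) frob_dot_le.
Qed.

Lemma normr_le_frob u : `|u| <= frob u.
Proof.
rewrite [leLHS]/Num.Def.normr/= mx_normrE bigmax_le // => ij _.
rewrite -(@ler_pXn2r _ 2) ?nnegrE // sqr_frob frob_dotE real_normK ?num_real //.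
rewrite (bigD1 ij) //= -expr2 lerDl.
by apply: sumr_ge0 => i _; rewrite -expr2 sqr_ge0.
Qed.

Lemma frob_le_normr u : frob u <= (p * q)%:R * `|u|.
Proof.
rewrite -(@ler_pXn2r _ 2) ?nnegrE ?mulr_ge0 // sqr_frob frob_dotE exprMn.
have h ij : u ij.1 ij.2 * u ij.1 ij.2 <= `|u| ^+ 2.
  rewrite -expr2 -real_normK ?num_real // ler_pXn2r ?nnegrE //.
  by rewrite [leRHS]/Num.Def.normr/= mx_normrE (le_bigmax _ _ ij).
apply: (le_trans (ler_sum _ (fun i _ => h i))).
rewrite sumr_const card_prod !card_ord -[leLHS]mulr_natl.
rewrite ler_wpM2r ?sqr_ge0 // -natrX ler_nat.
by case: (p * q)%N => // k; rewrite expnS expn1 leq_pmulr.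
Qed.

(** Completeness comes from the sup norm, equivalent to [frob]. Letting l tend to infinity keeps the
    bound b k, which becomes the convergence rate of the algorithm. *)
Lemma frob_cvg_cauchy (x : nat -> E) (b : nat -> R) :
    (forall k l, (k <= l)%N -> frob (x l - x k) <= b k) -> b @ \oo --> (0 : R) ->
  exists y, forall k, frob (y - x k) <= b k.
Proof.
move=> hx hb.
have : cvg (x @ \oo).
  apply: cauchy_cvg; apply: cauchy_exP => e e0; rewrite /fmapE -ball_normE /ball_.
  move/cvgr0Pnorm_lt: hb => /(_ e e0) [k _ hk].
  exists (x k), k => // l /= kl; rewrite distrC.
  apply: (le_lt_trans (normr_le_frob _)); apply: (le_lt_trans (hx _ _ kl)).
  by apply: (le_lt_trans (ler_norm _)); apply: hk => /=.
move=> /cvg_ex [y hy]; exists y => k; apply/ler_addgt0Pl => e e0.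
have K0 : 0 < (p * q)%:R + 1 :> R by rewrite ltr_wpDl.
have /cvgrPdist_lt /(_ (e / ((p * q)%:R + 1))) := hy.
rewrite divr_gt0 // => /(_ isT) [l _ hl].
pose j := maxn k l.
apply: (le_trans (frob_triangleB _ (x j) _)); apply: lerD; last exact/hx/leq_maxl.
apply: (le_trans (frob_le_normr _)).
have /= := hl j (leq_maxr _ _); rewrite ltr_pdivlMr // => /ltW; apply: le_trans.
by rewrite mulrC ler_wpM2l // lerDl.
Qed.

(* Adherence is phrased with [frob], since the library topology on matrices is
   that of the sup norm. *)
Definition frob_closed (K : set E) : Prop :=
  forall u, (forall e, 0 < e -> exists2 z, K z & frob (u - z) < e) -> K u.

(** [vec_mx] is isometric for the sup norm, so K comes from a closed bounded, hence compact, set of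
    row vectors; [phi], being 1-Lipschitz for [frob], is continuous there. *)
Lemma frob_min (K : set E) (phi : E -> R) (c : E) (rho : R) :
    K !=set0 -> (forall u, K u -> frob (u - c) <= rho) -> frob_closed K ->
    (forall u v, phi u - phi v <= frob (u - v)) ->
  exists2 y, K y & forall z, K z -> phi y <= phi z.
Proof.
move=> [k0 Kk0] hb hcl hphi.
(* The [+ 1] keeps the comparison constant positive even when [p * q] is 0. *)
have N0 : 0 < (p * q)%:R + 1 :> R by rewrite ltr_wpDl.
have hn (u : E) : frob u <= ((p * q)%:R + 1) * `|u|.
  by apply: (le_trans (frob_le_normr _)); rewrite ler_wpM2r // lerDl.
have nv (v : 'rV[R]_(p * q)) : `|vec_mx v : E| = `|v|.
  have hx m n (u : 'M[R]_(m, n)) : `|u| = \big[Num.max/0]_ij `|u ij.1 ij.2|.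
    exact: mx_normrE.
  apply: le_anti; apply/andP; split; rewrite [leLHS]hx; apply: bigmax_le => //.
    move=> ij _; rewrite mxE hx.
    exact: (le_bigmax _ (fun ij : 'I_1 * 'I_(p * q) => `|v ij.1 ij.2|)
      (ord0, mxvec_index ij.1 ij.2)).
  move=> [i j] _ /=; rewrite ord1; case/mxvec_indexP: j => j1 j2; rewrite hx.
  have := le_bigmax 0 (fun ij : 'I_p * 'I_q => `|(vec_mx v : E) ij.1 ij.2|) (j1, j2).
  by rewrite /= mxE.
pose A := [set v : 'rV[R]_(p * q) | K (vec_mx v)].
have A0 : A !=set0 by exists (mxvec k0); rewrite /A /= mxvecK.
have cA : compact A.
  apply: bounded_closed_compact.
    exists (rho + frob c); split; first exact: num_real.
    move=> x hx v Av; apply: (le_trans _ (ltW hx)); rewrite -nv.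
    apply: (le_trans (normr_le_frob _)).
    rewrite -(subrK c (vec_mx v)); apply: (le_trans (frob_triangle _ _)).
    by rewrite lerD2r; exact: hb.
  move=> v hv; apply: hcl => e e0.
  have [] := hv (ball v (e / ((p * q)%:R + 1))); first by apply: nbhsx_ballx; rewrite divr_gt0.
  move=> w [Aw]; rewrite -ball_normE /ball_ /= => hw; exists (vec_mx w) => //.
  rewrite -linearB /=; apply: (le_lt_trans (hn _)); rewrite nv mulrC -ltr_pdivlMr //.
have [|v vA hv] := @compact_EVT_min _ _ (fun v : 'rV[R]_(p * q) => phi (vec_mx v)) A A0 cA.
  apply: continuous_subspaceT => v U /nbhs_ballP [e /= e0 eU].
  apply/nbhs_ballP; exists (e / ((p * q)%:R + 1)); first by rewrite /= divr_gt0.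
  move=> w; rewrite -ball_normE /ball_ /= => hw; apply: eU; rewrite -ball_normE /ball_ /=.
  have h : frob (vec_mx v - vec_mx w : E) < e.
    rewrite -linearB /=; apply: (le_lt_trans (hn _)); rewrite nv mulrC -ltr_pdivlMr //.
  suff : `|phi (vec_mx v) - phi (vec_mx w)| < e :> R by [].
  rewrite ltr_norml (le_lt_trans (hphi _ _) h) andbT ltrNl opprB.
  by rewrite (le_lt_trans (hphi _ _)) // frob_distC.
exists (vec_mx v); first by move: vA; rewrite inE.
by move=> z Kz; have := hv (mxvec z); rewrite mxvecK inE /A /= mxvecK; exact.
Qed.

(** * Orthogonal projectors *)

Definition orth_projector (P : {linear E -> E}) : Prop :=
  (forall u, P (P u) = P u) /\ (forall u v, frob_dot (P u) v = frob_dot u (P v)).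

Lemma orth_projector_dot (P : {linear E -> E}) u v :
  orth_projector P -> frob_dot (P u) (v - P v) = 0.
Proof. by move=> [Pi Ps]; rewrite Ps linearB /= Pi subrr frob_dotC frob_dot0l. Qed.

Lemma orth_projector_pyth (P : {linear E -> E}) u :
  orth_projector P -> frob u ^+ 2 = frob (P u) ^+ 2 + frob (u - P u) ^+ 2.
Proof.
move=> hP; have := orth_projector_dot u u hP.
have : u = P u + (u - P u) by rewrite addrC subrK.
move: (u - P u) => w e h.
by rewrite {1}e !sqr_frob frob_dotDl !frob_dotDr (frob_dotC w (P u)) h addr0 add0r.
Qed.

Lemma orth_projector_le (P : {linear E -> E}) u :
  orth_projector P -> frob (P u) <= frob u.
Proof.
move=> hP; rewrite -(@ler_pXn2r _ 2) ?nnegrE //.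
by rewrite (orth_projector_pyth u hP) lerDl sqr_ge0.
Qed.

Lemma orth_projectorC_le (P : {linear E -> E}) u :
  orth_projector P -> frob (u - P u) <= frob u.
Proof.
move=> hP; rewrite -(@ler_pXn2r _ 2) ?nnegrE //.
by rewrite (orth_projector_pyth u hP) lerDr sqr_ge0.
Qed.

Definition lin_subspace (S : set E) : Prop :=
  S 0 /\ forall a u v, S u -> S v -> S (a *: u + v).

(** The trace of P as an endomorphism, in the basis of the [delta_mx i j]; for an orthogonal
    projector it is the dimension of the range. *)
Definition frob_trace (P : E -> E) : R :=
  \sum_i \sum_j P (delta_mx i j) i j.

Lemma frob_trace_dyad w : \sum_i \sum_j (frob_dot (delta_mx i j) w *: w) i j = frob w ^+ 2.
Proof.
rewrite sqr_frob; apply: eq_bigr => i _; apply: eq_bigr => j _.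
rewrite mxE; congr (_ * _).
rewrite /frob_dot (bigD1 i) //= (bigD1 j) //= mxE !eqxx mul1r.
rewrite !big1 ?addr0 // => [k ki|k kj].
  by rewrite big1 // => l _; rewrite mxE (negbTE ki) mul0r.
by rewrite mxE (negbTE kj) andbF mul0r.
Qed.

(** Bounds the trace of a projector by [p * q], so that a projector of maximal trace exists. *)
Lemma frob_delta_le i j (P : {linear E -> E}) :
  orth_projector P -> P (delta_mx i j) i j <= 1.
Proof.
move=> hP.
have d1 : frob (delta_mx i j : E) = 1.
  rewrite /frob /frob_dot (bigD1 i) //= (bigD1 j) //= mxE !eqxx mulr1.
  rewrite !big1 ?addr0 ?sqrtr1 // => [k ki|k kj].
    by rewrite big1 // => l _; rewrite mxE (negbTE ki) mul0r.
  by rewrite mxE (negbTE kj) andbF mul0r.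
have := orth_projector_le (delta_mx i j) hP; rewrite d1; apply: le_trans.
apply: le_trans (normr_le_frob _); apply: le_trans (ler_norm _) _.
by rewrite [leRHS]/Num.Def.normr/= mx_normrE; exact: (le_bigmax _ _ (i, j)).
Qed.

(* A projector of maximal trace (= rank) among those with range in S has range S:
   otherwise the dyad of a vector of S orthogonal to its range can be added. *)
Lemma orth_projector_exists (S : set E) : lin_subspace S ->
  exists P : {linear E -> E}, [/\ orth_projector P, (forall u, S (P u)) &
    (forall u, S u -> P u = u)].
Proof.
move=> [S0 SD].
pose Q (k : nat) := `[< exists P : {linear E -> E}, [/\ orth_projector P,
   (forall u, S (P u)) & frob_trace P = k%:R] >].
have Q0 : exists k, Q k.
  exists 0%N; apply/asboolP; exists (\0 : E -> E)%R; split => //.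
    by split => // u v /=; rewrite frob_dot0l frob_dotC frob_dot0l.
  by rewrite /frob_trace big1 // => i _; rewrite big1 // => j _; rewrite mxE.
have Qb k : Q k -> (k <= p * q)%N.
  move=> /asboolP [P [hP _ hk]]; rewrite -(ler_nat R) -hk.
  apply: (@le_trans _ _ (\sum_(i < p) \sum_(j < q) 1)); last first.
    by rewrite !sumr_const !card_ord -mulrnA mulnC.
  by apply: ler_sum => i _; apply: ler_sum => j _; exact: frob_delta_le.
case: (ex_maxnP Q0 Qb) => k /asboolP [P [hP SP hk]] kmax.
exists P; split => // v Sv.
apply: contrapT => /eqP; rewrite eq_sym -subr_eq0 => vn.
have [Pi Ps] := hP.
pose w0 := v - P v; pose w := (frob w0)^-1 *: w0.
have w00 : frob w0 != 0 by apply: contra_neq vn => /frob_eq0.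
have w1 : frob w = 1 by rewrite frobZ ger0_norm ?invr_ge0 // mulVf.
have Sw : S w.
  rewrite -[w]addr0; apply: (SD _ _ _ _ S0); rewrite /w0 addrC -scaleN1r.
  exact: SD.
have Pw : P w = 0 by rewrite linearZ /= linearB /= Pi subrr scaler0.
clearbody w.
pose P' u := P u + frob_dot u w *: w.
have lP' : linear P'.
  move=> a u u1; rewrite /P' linearP frob_dotDl frob_dotZl scalerDl scalerDr scalerA.
  by rewrite addrACA.
pose P1 := GRing.isLinear.Build _ _ _ _ P' lP'.
pose PP : {linear E -> E} := HB.pack P' P1.
have : Q k.+1.
  apply/asboolP; exists PP; split.
  - split => u => /= [|u']; rewrite /P'.
      rewrite linearD linearZ /= Pw scaler0 addr0 Pi frob_dotDl frob_dotZl.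
      by rewrite -sqr_frob w1 Ps Pw (frob_dotC u 0) frob_dot0l add0r expr1n mulr1.
    rewrite frob_dotDl frob_dotDr Ps frob_dotZl frob_dotZr (frob_dotC w) //.
    by rewrite mulrC.
  - by move=> u; rewrite /= /P' addrC; exact: SD.
  - rewrite /frob_trace -natr1 -hk -(expr1n R 2) -w1 -frob_trace_dyad /frob_trace.
    rewrite -big_split; apply: eq_bigr => i _; rewrite -big_split.
    by apply: eq_bigr => j _; rewrite /= /P' mxE.
by move/kmax; rewrite ltnn.
Qed.

Lemma lin_subspace_closed (S : set E) : lin_subspace S -> frob_closed S.
Proof.
move=> /orth_projector_exists [P [hP SP PS]] u hu.
suff <- : P u = u by [].
apply/eqP; rewrite -subr_eq0; apply/eqP/frob_eq0.
apply: le_anti; rewrite frob_ge0 andbT; apply/ler_addgt0Pl => e e0; rewrite addr0.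
have [|z Sz uz] := hu (e / 2); first lra.
have -> : P u - u = P (u - z) - (u - z) by rewrite linearB /= (PS z) // opprB addrA subrK.
by apply: (le_trans (frob_triangle _ _)); rewrite frobN; have := orth_projector_le (u - z) hP; lra.
Qed.

End Frobenius.

Lemma frob_mulmx {R : realType} {p q s : nat} (A : 'M[R]_(p, q)) (B : 'M[R]_(q, s)) :
  frob (A *m B) <= frob A * frob B.
Proof.
have h (i : 'I_p) (j : 'I_s) :
    (A *m B) i j ^+ 2 <= (\sum_k A i k * A i k) * (\sum_k B k j * B k j).
  have -> : \sum_k A i k * A i k = frob (row i A) ^+ 2.
    by rewrite sqr_frob /frob_dot big_ord1; apply: eq_bigr => k _; rewrite !mxE.
  have -> : \sum_k B k j * B k j = frob (row j B^T) ^+ 2.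
    by rewrite sqr_frob /frob_dot big_ord1; apply: eq_bigr => k _; rewrite !mxE.
  have := frob_dot_abs (row i A) (row j B^T).
  have -> : frob_dot (row i A) (row j B^T) = (A *m B) i j.
    by rewrite /frob_dot big_ord1 mxE; apply: eq_bigr => k _; rewrite !mxE.
  rewrite -exprMn -(real_normK (num_real ((A *m B) i j))) => h.
  rewrite ler_pXn2r ?nnegrE ?mulr_ge0 ?frob_ge0 //.
rewrite -(@ler_pXn2r _ 2) ?nnegrE ?mulr_ge0 ?frob_ge0 // exprMn !sqr_frob.
have -> : frob_dot B B = \sum_j \sum_k B k j * B k j by rewrite /frob_dot exchange_big.
rewrite /frob_dot mulr_suml; apply: ler_sum => i _.
by rewrite mulr_sumr; apply: ler_sum => j _; rewrite -expr2.
Qed.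

(** * Alternating projections on strictly differentiable sets *)

Section Tangency.
Context {R : realType} {p q : nat}.
Notation E := 'M[R]_(p, q).
Implicit Types (M : set E) (B X Y u v w t y z : E) (P Q : {linear E -> E}).

(* M is strictly differentiable at B, with tangent space the range of the
   projector P: chords near B are almost in the range, and every small step in
   the range almost stays in M. *)
Definition tangent_at M B P : Prop :=
  forall d, 0 < d -> exists2 rho, 0 < rho &
  (forall y z, M y -> M z -> frob (y - B) <= rho -> frob (z - B) <= rho ->
     frob (y - z - P (y - z)) <= d * frob (y - z)) /\
  (forall z t, M z -> frob (z - B) <= rho -> P t = t -> frob t <= rho ->
     exists2 y, M y & frob (y - z - t) <= d * frob t).

(** Matrices of rank r can converge to lower rank, so closedness holds only near a point of rank r.
    All radii up to rho are included so that the ball can be shrunk to meet other constraints. *)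
Definition locally_closed M B : Prop :=
  exists2 rho, 0 < rho &
    forall r, r <= rho -> frob_closed [set u | M u /\ frob (u - B) <= r].

Definition frob_closest M X Y : Prop :=
  M Y /\ forall Z, M Z -> frob (X - Y) <= frob (X - Z).

Lemma frob_closest_near M B X Y :
  M B -> frob_closest M X Y -> frob (Y - B) <= 2 * frob (X - B).
Proof.
move=> MB [_ /(_ B MB)] h; apply: (le_trans (frob_triangleB _ X _)).
by rewrite (frob_distC Y); lra.
Qed.

Lemma frob_closest_exists M B : M B -> locally_closed M B ->
  exists2 rho, 0 < rho & forall X, frob (X - B) <= rho -> exists Y, frob_closest M X Y.
Proof.
move=> MB [rho rho0 hcl]; exists (rho / 2); first lra.
move=> X hX; have [||||Y [MY _] hY] := @frob_min _ _ _ [set u | M u /\ frob (u - B) <= rho]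
    (fun Z => frob (X - Z)) B rho.
- by exists B; split => //; rewrite subrr frob0 ltW.
- by move=> u [].
- exact: hcl.
- move=> u v; apply: (le_trans (frob_sub_le _ _)).
  by rewrite opprB addrC addrA subrK frob_distC.
exists Y; split => // Z MZ; have [hZ|hZ] := leP (frob (Z - B)) rho; first exact: hY.
(* A point Z outside the ball is farther from X than B is, since [frob (X - B) <= rho / 2]. *)
have BB : frob (B - B) <= rho by rewrite subrr frob0 ltW.
have h := hY B (conj MB BB).
have := frob_triangleB Z X B; rewrite (frob_distC Z X); lra.
Qed.

(* Moving a closest point along its tangential residual P (X - Y) cannot bring it
   closer to X, so that residual is of smaller order. *)
Lemma frob_closest_orth M B P : M B -> orth_projector P -> tangent_at M B P ->
  forall d, 0 < d -> exists2 rho, 0 < rho & forall X Y, frob (X - B) <= rho ->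
    frob_closest M X Y -> frob (P (X - Y)) <= d * frob (X - Y).
Proof.
move=> MB hP hM d d0; pose e := Num.min (d / 4) (1 / 2).
have e0 : 0 < e by rewrite lt_min; apply/andP; split; lra.
have e1 : e <= d / 4 by rewrite ge_min lexx.
have e2 : e <= 1 / 2 by rewrite ge_min lexx orbT.
have [rho rho0 [_ hstep]] := hM e e0; exists (rho / 2); first lra.
move=> X Y hX hY; have := frob_closest_near MB hY => hYB.
pose t := P (X - Y); have [MY hmin] := hY.
have tX : frob t <= frob (X - Y) by exact: orth_projector_le.
have tXB := hmin B MB.
have [||||y My hy] := hstep Y t => //; [lra|exact: hP.1|lra|].
have h1 := hmin y My.
have := frob_triangleB X (Y + t) y; rewrite opprD addrA.
rewrite (frob_distC (Y + t)) opprD addrA => h2.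
have := orth_projector_pyth (X - Y) hP; rewrite -/t => h3.
have v0 := frob_ge0 (X - Y - t); have t0 := frob_ge0 t.
have vX : frob (X - Y - t) <= frob (X - Y) by exact: orth_projectorC_le.
have D0 := frob_ge0 (X - Y).
move: h1 h2 h3 hy v0 t0 vX D0; move: (frob (X - Y - t)) (frob t) (frob (X - Y)).
move: (frob (X - y)) (frob (y - Y - t)) => D1 r v a D.
move=> h1 h2 h3 h4 v0 a0 vD D0.
(* Squaring this and using Pythagoras, D^2 = a^2 + v^2, leaves a^2 <= 2 e a v + e^2 a^2; then e <= 1
   / 2 and e <= d / 4 give a <= d D. *)
have h5 : D <= v + e * a by lra.
have h6 : D ^+ 2 <= (v + e * a) ^+ 2 by rewrite ler_pXn2r ?nnegrE //; nra.
have h7 : a * a <= a * (2 * e * D + a / 4).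
  have : e ^+ 2 <= 1 / 4 by nra.
  have : v * (e * a) <= D * (e * a) by rewrite ler_wpM2r //; nra.
  have : a ^+ 2 * e ^+ 2 <= a ^+ 2 * (1 / 4) by rewrite ler_wpM2l ?sqr_ge0 //; nra.
  nra.
have [->|an0] := eqVneq a 0; first by apply: mulr_ge0 => //; exact: ltW.
have a1 : 0 < a by rewrite lt0r an0.
have h8 : a <= 2 * e * D + a / 4 by rewrite -(ler_pM2l a1).
have : e * D <= d / 4 * D by rewrite ler_wpM2r.
lra.
Qed.

(** Y - z - P (X - z) is the normal part of the chord Y - z minus the tangential residual P (X - Y).
    By minimality the chord is at most twice as long as X - z, so it costs two thirds of d and the
    residual one third. *)
Lemma frob_closest_linear M B P : M B -> orth_projector P -> tangent_at M B P ->
  forall d, 0 < d -> exists2 rho, 0 < rho & forall X Y z, frob (X - B) <= rho ->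
    frob_closest M X Y -> M z -> frob (z - B) <= rho ->
    frob (Y - z - P (X - z)) <= d * frob (X - z).
Proof.
move=> MB hP hM d d0; have d3 : 0 < d / 3 by lra.
have [r1 r10 h1] := frob_closest_orth MB hP hM d3.
have [r2 r20 [h2 _]] := hM _ d3.
exists (Num.min r1 (r2 / 2)); first by rewrite lt_min r10 /=; lra.
move=> X Y z; rewrite !le_min => /andP[X1 X2] hY Mz /andP[_ z2].
have hYB := frob_closest_near MB hY.
have h3 := h1 _ _ X1 hY.
have h4 : frob (Y - z - P (Y - z)) <= d / 3 * frob (Y - z).
  by apply: h2 => //; [exact: hY.1|lra|lra].
have h5 := hY.2 z Mz.
have h6 := frob_triangleB Y X z; rewrite (frob_distC Y X) in h6.
have -> : Y - z - P (X - z) = (Y - z - P (Y - z)) - P (X - Y).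
  by rewrite -(subrKA Y X (- z)) (linearD P) /= opprD [- P (X - Y) - _]addrC addrA.
apply: (le_trans (frob_triangle _ _)); rewrite frobN.
have : d / 3 * frob (X - Y) <= d / 3 * frob (X - z) by rewrite ler_wpM2l // ltW.
have : d / 3 * frob (Y - z) <= d / 3 * (2 * frob (X - z)).
  by rewrite (ler_wpM2l (ltW d3)) //; lra.
lra.
Qed.

(** Among the points y of M in a ball, take one minimising the defect w = t - P (y - B). A tangent
    step by w stays in M up to half of w, hence would at least halve the defect; so w = 0. *)
Lemma tangent_at_onto M B P : M B -> orth_projector P -> tangent_at M B P ->
    locally_closed M B ->
  exists2 rho, 0 < rho & forall t, P t = t -> frob t <= rho ->
    exists y, [/\ M y, P (y - B) = t & frob (y - B) <= 4 * frob t].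
Proof.
move=> MB hP hM [r1 r10 hcl].
have [|r2 r20 [hch hstep]] := hM (1 / 2); first lra.
pose r := Num.min r1 r2.
have r0 : 0 < r by rewrite lt_min r10.
have rr1 : r <= r1 by rewrite ge_min lexx.
have rr2 : r <= r2 by rewrite ge_min lexx orbT.
exists (r / 8); first lra.
move=> t Pt tr.
have [||||y [My hy] hmin] := @frob_min _ _ _ [set u | M u /\ frob (u - B) <= r]
    (fun y => frob (P (y - B) - t)) B r.
- by exists B; split => //; rewrite subrr frob0 ltW.
- by move=> u [].
- exact: hcl.
- move=> u v; apply: (le_trans (frob_sub_le _ _)).
  rewrite opprB addrA subrK -linearB /= opprB addrA subrK.
  exact: orth_projector_le.
have BB : frob (B - B) <= r by rewrite subrr frob0 ltW.
have hB := hmin B (conj MB BB); rewrite subrr linear0 sub0r frobN in hB.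
have h1 : frob (P (y - B)) <= 2 * frob t.
  by have := frob_sub_le (P (y - B)) t; lra.
have h2 : frob (y - B - P (y - B)) <= 1 / 2 * frob (y - B).
  by apply: hch => //; [lra|rewrite subrr frob0 ltW].
have h3 := frob_sub_le (y - B) (P (y - B)).
(* As [frob t <= r / 8], the minimiser is within r / 2 of B, which leaves room in the ball for the
   step to y'. *)
have h4 : frob (y - B) <= 4 * frob t by lra.
exists y; split => //; apply/eqP; rewrite -subr_eq0; apply/eqP/frob_eq0.
pose w := t - P (y - B).
have Pw : P w = w by rewrite /w linearB /= Pt hP.1.
have wt : frob w <= frob t by rewrite /w frob_distC.
have [||||y' My' hy'] := hstep y w => //; [lra|lra|].
have h5 : frob (y' - y) <= 3 / 2 * frob w.
  by have := frob_sub_le (y' - y) w; lra.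
have h6 := frob_triangleB y' y B.
have h7 : frob (P (y - B) - t) <= frob (P (y' - B) - t).
  by apply: hmin; split => //; lra.
have e1 : P (y' - B) - t = P (y' - y - w).
  by rewrite (linearB P (y' - y)) /= Pw /w -(subrKA y y' (- B)) linearD /= opprB addrA.
rewrite {}e1 in h7.
have h8 := orth_projector_le (y' - y - w) hP.
have h9 := frob_ge0 w.
have wE : frob w = frob (P (y - B) - t) by rewrite /w frob_distC.
by apply: le_anti; rewrite frob_ge0 andbT -wE; lra.
Qed.

(** Both identities say that the range of P lies in that of Q, and each is the adjoint of the other.
    Here P u is no longer than Q (P u), so Pythagoras for Q leaves no remainder. *)
Lemma orth_projector_absorb Q P : orth_projector Q -> orth_projector P ->
  (forall u, P (Q u) = P u) -> forall u, Q (P u) = P u.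
Proof.
move=> hQ hP PQ u; apply/esym/eqP; rewrite -subr_eq0; apply/eqP/frob_eq0/eqP.
rewrite -sqrf_eq0; apply/eqP/le_anti; rewrite sqr_ge0 andbT.
have := orth_projector_pyth (P u) hQ.
have : frob (P u) <= frob (Q (P u)) by rewrite -{1}hP.1 -PQ orth_projector_le.
rewrite -(@ler_pXn2r _ 2) ?nnegrE ?frob_ge0 // => h1 h2; lra.
Qed.

Lemma orth_projector_absorbV Q P : orth_projector Q -> orth_projector P ->
  (forall u, Q (P u) = P u) -> forall u, P (Q u) = P u.
Proof.
move=> hQ hP QP u; apply/eqP; rewrite -subr_eq0 -linearB /=; apply/eqP/frob_eq0/eqP.
rewrite -sqrf_eq0 sqr_frob hP.2 hP.1 frob_dotDl frob_dotNl hQ.2.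
by rewrite QP subrr.
Qed.

(** Uniqueness identifies any selection of closest points of L with its projector. *)
Lemma frob_closest_projector (L : set E) P y : orth_projector P ->
  (forall u, L u <-> P u = u) -> frob_closest L y (P y) /\
  forall x, frob_closest L y x -> x = P y.
Proof.
move=> hP LP.
have pyth x : L x -> frob (y - x) ^+ 2 = frob (P y - x) ^+ 2 + frob (y - P y) ^+ 2.
  move=> /LP Px; rewrite (orth_projector_pyth (y - x) hP) (linearB P) /= Px.
  by rewrite opprB addrA subrK.
have LPy : L (P y) by apply/LP; exact: hP.1.
split=> [|x [Lx /(_ _ LPy)]].
  split => // x /pyth e; rewrite -(@ler_pXn2r _ 2) ?nnegrE ?frob_ge0 // e.
  by rewrite lerDr sqr_ge0.
rewrite -(@ler_pXn2r _ 2) ?nnegrE ?frob_ge0 // (pyth x Lx) gerDr => h.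
apply/esym/eqP; rewrite -subr_eq0; apply/eqP/frob_eq0/eqP.
by rewrite -sqrf_eq0; apply/eqP/le_anti; rewrite h sqr_ge0.
Qed.

Lemma lin_subspace_tangent_at (L : set E) B P : lin_subspace L -> L B ->
  (forall u, L u <-> P u = u) -> tangent_at L B P.
Proof.
move=> [_ LD] LB LP d d0; exists 1 => //; split.
  move=> y z /LP Py /LP Pz _ _; rewrite linearB /= Py Pz subrr frob0.
  by rewrite mulr_ge0 ?frob_ge0 // ltW.
move=> z t Lz _ /LP Lt _; exists (1 *: z + t); first exact: LD.
by rewrite scale1r (addrC z) addrK subrr frob0 mulr_ge0 ?frob_ge0 // ltW.
Qed.

End Tangency.

(** * Contraction by one alternation and geometric convergence *)

Section AlternatingProjections.
Context {R : realType} {p q : nat}.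
Notation E := 'M[R]_(p, q).
Variables (M1 L : set E) (B : E) (P1 PL P : {linear E -> E}).
Notation M := (M1 `&` L).
Hypotheses (MB : M B) (oP1 : orth_projector P1) (oPL : orth_projector PL)
  (oP : orth_projector P) (hPL : forall u, L u <-> PL u = u)
  (PP1 : forall u, P (P1 u) = P u) (PPL : forall u, P (PL u) = P u)
  (hM1 : tangent_at M1 B P1) (hM : tangent_at M B P) (cM1 : locally_closed M1 B).
(** [c'] bounds the cosine between the tangent spaces modulo the range of P; the gap from [c'] to
    [c] pays for the linearisation errors. *)
Variables (c' c : R).
Hypotheses (c'0 : 0 <= c') (c'c : c' < c) (c1 : c < 1).
Hypothesis angle : forall u v, P1 u = u -> P u = 0 -> PL v = v -> P v = 0 ->
  frob_dot u v <= c' * (frob u * frob v).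

Let P1P u : P1 (P u) = P u := orth_projector_absorb oP1 oP PP1 u.
Let PLP u : PL (P u) = P u := orth_projector_absorb oPL oP PPL u.

(** The squared norm of PL (P1 u) is its product with P1 u. Both vectors are orthogonal to the range
    of P, because P absorbs P1 and PL, so the angle bound applies and one factor cancels. *)
Lemma PL_P1_contraction u : P u = 0 -> frob (PL (P1 u)) <= c' * frob u.
Proof.
move=> Pu; have := angle (oP1.1 u) _ (oPL.1 (P1 u)) _.
rewrite PPL PP1 Pu => /(_ erefl erefl).
have -> : frob_dot (P1 u) (PL (P1 u)) = frob (PL (P1 u)) ^+ 2.
  by rewrite sqr_frob oPL.2 oPL.1.
have h := orth_projector_le u oP1; rewrite mulrA => h1.
have [->|n0] := eqVneq (frob (PL (P1 u))) 0; first by rewrite mulr_ge0 ?frob_ge0.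
have n1 : 0 < frob (PL (P1 u)) by rewrite lt0r n0 frob_ge0.
rewrite expr2 ler_pM2r // in h1; apply: (le_trans h1); exact: ler_wpM2l.
Qed.

Lemma locally_closedI : locally_closed M B.
Proof.
have [rho rho0 h] := cM1; exists rho => // r rr u hu.
have [Mu ur] : M1 u /\ frob (u - B) <= r.
  by apply: (h r rr) => e /hu [z [[? ?] ?] ?]; exists z.
have sL : lin_subspace L.
  split; first by apply/hPL; rewrite linear0.
  by move=> x v w /hPL Lv /hPL Lw; apply/hPL; rewrite linearP /= Lv Lw.
split => //; split => //; apply: (lin_subspace_closed sL) => e /hu [z [[_ Lz] _] uz].
by exists z.
Qed.

Lemma alternating_step d : 0 < d -> exists2 rho, 0 < rho &
  forall X y z, frob (X - B) <= rho -> frob_closest M1 X y -> frob_closest M X z ->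
  frob (PL y - z) <= c * frob (X - z) /\ frob (P (PL y - X)) <= d * frob (X - z).
Proof.
move=> d0; pose e := Num.min d ((c - c') / 2).
have cc : 0 < c - c' by rewrite subr_gt0.
have e0 : 0 < e by rewrite lt_min d0 /= divr_gt0.
have ed : e <= d by rewrite ge_min lexx.
have ec : e <= (c - c') / 2 by rewrite ge_min lexx orbT.
have [r1 r10 h1] := frob_closest_linear MB.1 oP1 hM1 e0.
have [r2 r20 h2] := frob_closest_orth MB oP hM e0.
exists (Num.min (r1 / 2) r2); first by rewrite lt_min r20 andbT; lra.
move=> X y z; rewrite le_min => /andP[Xr1 Xr2] hy hz.
have [Mz hz2] := hz.
have zB := frob_closest_near MB hz.
have h3 : frob (y - z - P1 (X - z)) <= e * frob (X - z).
  by apply: h1 => //; [lra|exact: Mz.1|lra].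
have h4 := h2 _ _ Xr2 hz.
have zL : PL z = z by apply/hPL; exact: Mz.2.
set u := X - z in h3 h4 *.
set er := y - z - P1 u in h3.
(* The residual u splits into P u, negligible because z is closest, and u - P u, which PL after P1
   contracts by c'; [er] is the linearisation error of y. Two errors of size e explain the half of c
   - c' in e. *)
have hyz : PL y - z = P u + PL (P1 (u - P u)) + PL er.
  rewrite -{1}zL -linearB /= (linearB P1) /= P1P.
  have -> : P u = PL (P u) by rewrite PLP.
  rewrite -!linearD PLP; congr (PL _); rewrite /er.
  by move: (P u) (P1 u) (y - z) => a b w; rewrite (addrC a) subrK addrC subrK.
have hc : frob (PL (P1 (u - P u))) <= c' * frob u.
  apply: (le_trans (PL_P1_contraction _)).
    by rewrite linearB /= oP.1 subrr.
  by rewrite ler_wpM2l // orth_projectorC_le.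
have her := orth_projector_le er oPL.
have eX : PL y - X = (PL y - z) - u by rewrite /u opprB addrA subrK.
clearbody er; clearbody u.
split.
  rewrite hyz; apply: (le_trans (frob_triangle _ _)).
  have := frob_triangle (P u) (PL (P1 (u - P u))).
  have : e * frob u <= (c - c') / 2 * frob u by rewrite ler_wpM2r ?frob_ge0.
  lra.
(* P fixes P u, kills the contracted term and cancels against u: of the displacement only P er
   remains. *)
rewrite eX hyz (linearB P) !(linearD P) /= !(PPL, PP1) (linearB P) /= !oP.1 subrr.
rewrite addr0 addrAC subrr add0r.
apply: (le_trans (orth_projector_le _ oP)); apply: (le_trans h3).
by rewrite ler_wpM2r ?frob_ge0.
Qed.

Theorem alternating_projections (eps : R) : 0 < eps ->
  exists2 s, 0 < s & forall A z0 : E, frob (A - B) < s -> frob_closest M A z0 ->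
  forall X Y : nat -> E, X 0%N = A ->
  (forall k, (exists y, frob_closest M1 (X k) y) -> frob_closest M1 (X k) (Y k.+1)) ->
  (forall k, X k.+1 = PL (Y k.+1)) ->
  exists Xoo, [/\ M Xoo, frob (Xoo - z0) <= eps * frob (A - z0) &
    forall k, frob (Xoo - X k) <= 2 / (1 - c) * c ^+ k * frob (A - z0)].
Proof.
move=> eps0; have c0 : 0 < c by exact: le_lt_trans c'c.
have c10 : 0 < 1 - c by rewrite subr_gt0.
(* K is the sum of all powers of c, and S k below is the sum of the first k of them. *)
pose K := (1 - c)^-1.
have K0 : 0 < K by rewrite invr_gt0.
have KE : K = K * c + 1.
  by rewrite -[1](mulVf (lt0r_neq0 c10)) -/K -mulrDr addrC subrK mulr1.
(* Chosen for the final estimate: the error is at most twice its component along P, which is at most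
   (d K + d) D. *)
pose d := eps / (2 * (1 + K)).
have d0 : 0 < d by rewrite divr_gt0 //; lra.
have dE : 2 * (d * (1 + K)) = eps.
  by rewrite /d; field; rewrite lt0r_neq0 //; lra.
have [r1 r10 h1] := alternating_step d0.
have [r2 r20 h2] := frob_closest_orth MB oP hM d0.
have [r3 r30 h3] := frob_closest_exists MB locally_closedI.
have [r4 r40 h4] := frob_closest_exists MB.1 cM1.
have half0 : 0 < 1 / 2 :> R by lra.
have [r5 r50 [h5 _]] := hM half0.
have [r6 r60 h6] := locally_closedI.
pose r := Num.min (Num.min r1 r2) (Num.min (Num.min r3 r4) (Num.min r5 r6)).
have r0 : 0 < r by rewrite !lt_min r10 r20 r30 r40 r50 r60.
have : r <= r by [].
rewrite {2}/r !le_min => /and3P[/andP[rr1 rr2] /andP[rr3 rr4] /andP[rr5 rr6]].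
(* The iterates drift from A by at most 2 K D with D <= s, so they remain within s (1 + 2 K) = r / 2
   of B. *)
pose s := r / (2 * (1 + 2 * K)).
have s0 : 0 < s by rewrite divr_gt0 //; lra.
have sE : 2 * (s * (1 + 2 * K)) = r.
  by rewrite /s; field; rewrite lt0r_neq0 //; lra.
clearbody s r d.
exists s => // A z0 As hz0 X Y X0 hY hX.
clear half0 r10 r20 r30 r40 r50 r60.
pose D := frob (A - z0).
have D0 : 0 <= D by exact: frob_ge0.
have Ds : D <= s by apply: (le_trans (hz0.2 B MB)); exact: ltW.
have ck0 k : 0 <= c ^+ k by rewrite exprn_ge0 // ltW.
have ck1 k : c ^+ k <= 1 by rewrite exprn_ile1 // ltW.
pose S k := K * (1 - c ^+ k).
have SS k : S k.+1 = S k + c ^+ k.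
  by rewrite /S exprS; have := congr1 (fun y => y * c ^+ k) KE; lra.
have SK k : S k <= K by rewrite /S; have := ck0 k; nra.
have S0 k : 0 <= S k by rewrite /S; have := ck1 k; nra.
have Xball k : frob (X k - A) <= 2 * D * S k -> frob (X k - B) <= r / 2.
  move=> h; apply: (le_trans (frob_triangleB _ A _)).
  have : D * S k <= s * K by rewrite ler_pM.
  move: sE As h; rewrite mulrDr mulr1; lra.
(* A new closest point of M is taken at every step. The total drift is of order D, but along P it
   grows only by d times the current distance to M. *)
have inv k : exists z, [/\ frob_closest M (X k) z, frob (X k - z) <= c ^+ k * D,
    frob (X k - A) <= 2 * D * S k & frob (P (X k - A)) <= d * D * S k].
  elim: k => [|k [z [hz zD XA PXA]]].
    exists z0; rewrite X0 expr0 mul1r subrr linear0 frob0; split => //.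
      by rewrite mulr_ge0 // mulr_ge0.
    by rewrite mulr_ge0 // mulr_ge0 // ltW.
  have XB := Xball k XA.
  have [|y0 hy0] := h4 (X k); first lra.
  have hy := hY k (ex_intro _ _ hy0).
  have [|a1 a2] := h1 (X k) _ _ _ hy hz; first lra.
  rewrite -hX in a1 a2.
  have a3 : frob (X k.+1 - A) <= 2 * D * S k.+1.
    rewrite SS; apply: (le_trans (frob_triangleB _ (X k) _)).
    have := frob_triangleB (X k.+1) z (X k); rewrite (frob_distC z).
    have := frob_ge0 (X k - z); nra.
  have [|z' hz'] := h3 (X k.+1); first by have := Xball _ a3; lra.
  exists z'; split => //.
    apply: (le_trans (hz'.2 z hz.1)); apply: (le_trans a1).
    by rewrite exprS -mulrA ler_wpM2l // ltW.
  rewrite SS -(subrKA (X k) (X k.+1) (- A)) linearD /=.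
  apply: (le_trans (frob_triangle _ _)).
  have : d * frob (X k - z) <= d * (c ^+ k * D) by rewrite ler_wpM2l // ltW.
  lra.
have step k : frob (X k.+1 - X k) <= 2 * (c ^+ k * D).
  have [z [hz zD XA _]] := inv k; have XB := Xball k XA.
  have [|y0 hy0] := h4 (X k); first lra.
  have hy := hY k (ex_intro _ _ hy0).
  have [|a1 _] := h1 (X k) _ _ _ hy hz; first lra.
  rewrite -hX in a1; have := frob_triangleB (X k.+1) z (X k); rewrite (frob_distC z (X k)).
  have : c * frob (X k - z) <= 1 * frob (X k - z) by rewrite ler_wpM2r ?frob_ge0 // ltW.
  lra.
have tele k l : (k <= l)%N -> frob (X l - X k) <= 2 * D * (S l - S k).
  elim: l => [|l IH]; first by rewrite leqn0 => /eqP->; rewrite !subrr frob0 mulr0.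
  rewrite leq_eqVlt => /predU1P[->|]; first by rewrite !subrr frob0 mulr0.
  rewrite ltnS => /IH {}IH; apply: (le_trans (frob_triangleB _ (X l) _)).
  by have := step l; rewrite SS; lra.
have cauchyX k l : (k <= l)%N -> frob (X l - X k) <= 2 / (1 - c) * c ^+ k * D.
  move=> /tele; rewrite -/K /S; move/le_trans; apply.
  have : 0 <= D * K * c ^+ l by rewrite !mulr_ge0 // ltW.
  lra.
have [|Xoo hXoo] := frob_cvg_cauchy cauchyX.
  rewrite -(mul0r D); apply: cvgM; last exact: cvg_cst.
  rewrite -(mulr0 (2 / (1 - c))); apply: cvgM; first exact: cvg_cst.
  by apply: cvg_expr; rewrite ger0_norm // ltW.
have cvgXoo e : 0 < e -> exists k, frob (Xoo - X k) < e /\ c ^+ k * D < e.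
  move=> e0; have : c ^+ k @[k --> \oo] --> (0 : R) by apply: cvg_expr; rewrite ger0_norm // ltW.
  (* The denominator serves both 2 K c^k D and c^k D, and is positive even when D = 0. *)
  move/cvgr0Pnorm_lt => /(_ (e / (2 * K * D + D + 1))).
  have dd : 0 < 2 * K * D + D + 1.
    have KD : 0 <= K * D by rewrite mulr_ge0 // ltW.
    lra.
  rewrite divr_gt0 // => /(_ isT) [k _ /(_ k (leqnn k))] /=.
  rewrite ger0_norm // ltr_pdivlMr // => hk; exists k.
  have a1 : 0 <= c ^+ k * (K * D) by rewrite !mulr_ge0 // ltW.
  have a2 : 0 <= c ^+ k * D by rewrite mulr_ge0.
  have := ck0 k; have := hXoo k; rewrite -/K; move: a1 a2 hk.
  by move: (c ^+ k) => x; split; lra.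
(* Local closedness needs approximating points of M inside the ball: z is within r / 4 of X k,
   itself within r / 2 of B. *)
have MXoo : M Xoo /\ frob (Xoo - B) <= r.
  apply: h6 => // e e0; have [|k [k1 k2]] := cvgXoo (Num.min (e / 2) (r / 4)).
    by rewrite lt_min; apply/andP; split; lra.
  rewrite !lt_min in k1 k2; case/andP: k1 => k1 k1'; case/andP: k2 => k2 k2'.
  have [z [hz zD XA _]] := inv k; have XB := Xball k XA.
  exists z; first split; [exact: hz.1| |].
    have := frob_triangleB z (X k) B; rewrite (frob_distC z (X k)) => a1.
    by apply: (le_trans a1); lra.
  by have := frob_triangleB Xoo (X k) z; lra.
exists Xoo; split => //; first exact: MXoo.1.
have PA : frob (P (Xoo - A)) <= d * D * K.
  apply/ler_addgt0Pl => e e0; have [k [k1 _]] := cvgXoo _ e0.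
  rewrite -(subrKA (X k) Xoo (- A)) linearD /=.
  apply: (le_trans (frob_triangle _ _)); apply: lerD.
    by apply: le_trans (ltW k1); exact: orth_projector_le.
  have [z [_ _ _ a]] := inv k; apply: (le_trans a).
  by rewrite ler_wpM2l // mulr_ge0 // ltW.
have AB : frob (A - B) <= s by exact: ltW.
have sr : s * 2 <= r.
  have sK : 0 <= s * K by rewrite mulr_ge0 // ltW.
  lra.
have PA0 : frob (P (A - z0)) <= d * D by apply: h2 => //; lra.
have zB := frob_closest_near MB hz0.
(* Xoo and z0 both lie in M near B, so their difference is at most twice its component along P. *)
have flat : frob (Xoo - z0 - P (Xoo - z0)) <= 1 / 2 * frob (Xoo - z0).
  by apply: h5; [exact: MXoo.1|exact: hz0.1|have := MXoo.2; lra|lra].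
have a1 := frob_sub_le (Xoo - z0) (P (Xoo - z0)).
have a2 : frob (P (Xoo - z0)) <= d * D * K + d * D.
  rewrite -(subrKA A Xoo (- z0)) linearD /=.
  by apply: (le_trans (frob_triangle _ _)); exact: lerD.
rewrite -/D -dE; lra.
Qed.

End AlternatingProjections.

(** * The angle *)

Section Angle.
Context {R : realType} {p q : nat}.
Notation E := 'M[R]_(p, q).
Variables (M1 L : set E) (B : E).

Let cosines (xi : R) : set R := [set z | exists2 B1, angle_set M1 L B M1 xi B1 &
  exists2 B2, angle_set M1 L B L xi B2 &
  z = frob_dot (B1 - B) (B2 - B) / (frob (B1 - B) * frob (B2 - B))].

(* Reflecting B2 through B shows that the supremum defining sigma is nonnegative. *)
Lemma sigma_lt_angle_bound (c : R) : lin_subspace L -> L B ->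
  (forall xi, 0 < xi -> angle_set M1 L B M1 xi !=set0 /\ angle_set M1 L B L xi !=set0) ->
  sigma M1 L B < c ->
  exists k xi, [/\ 0 <= k < c, 0 < xi & forall B1 B2,
    angle_set M1 L B M1 xi B1 -> angle_set M1 L B L xi B2 ->
    frob_dot (B1 - B) (B2 - B) <= k * (frob (B1 - B) * frob (B2 - B))].
Proof.
move=> sL LB hne hc; have [L0 LD] := sL.
pose S xi := sup (cosines xi).
have pos M xi u : angle_set M1 L B M xi u -> 0 < frob (u - B).
  move=> [_ uB _ _]; rewrite lt0r frob_ge0 andbT.
  by apply/eqP => /frob_eq0 /eqP; rewrite subr_eq0 => /eqP.
have ub xi : ubound (cosines xi) 1.
  move=> z [B1 /pos h1 [B2 /pos h2 ->]].
  by rewrite ler_pdivrMr ?mulr_gt0 // mul1r frob_dot_le.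
have hs xi : 0 < xi -> has_sup (cosines xi).
  move=> /hne [[B1 h1] [B2 h2]]; split; last by exists 1.
  by eexists; exists B1 => //; exists B2.
have mono xi xi' M u : xi <= xi' -> angle_set M1 L B M xi u -> angle_set M1 L B M xi' u.
  by move=> le [? ? h ?]; split => //; exact: le_trans le.
have S0 xi : 0 < xi -> 0 <= S xi.
  move=> xi0; have [[B1 h1] [B2 h2]] := hne _ xi0.
  have [MB2 nB2 lB2 oB2] := h2.
  pose B2' := -1 *: (B2 - B) + B.
  have eB2' : B2' - B = - (B2 - B) by rewrite /B2' addrK scaleN1r.
  have h2' : angle_set M1 L B L xi B2'.
    split.
    - by apply: (LD) => //; rewrite addrC -scaleN1r; exact: LD.
    - by move/eqP; rewrite -subr_eq0 eB2' oppr_eq0 subr_eq0 => /eqP.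
    - by rewrite eB2' frobN.
    - by move=> w hw; rewrite eB2' frob_dotNl oB2 // oppr0.
  have up z : cosines xi z -> z <= S xi.
    by move=> hz; apply: sup_upper_bound => //; exact: hs.
  have [d0|d0] := leP 0 (frob_dot (B1 - B) (B2 - B)).
    apply: (le_trans _ (up _ _)); last by exists B1 => //; exists B2.
    by rewrite divr_ge0 // mulr_ge0 // frob_ge0.
  apply: (le_trans _ (up _ _)); last by exists B1 => //; exists B2'.
  rewrite eB2' frob_dotNr divr_ge0 ?oppr_ge0 ?ltW // mulr_gt0 ?frobN //.
    exact: pos h1.
  exact: pos h2.
(* The supremum shrinks with xi and is bounded below, so the limit at 0 exists and is the infimum;
   hence some xi already has S xi < c. *)
have ndS : {in Interval (BRight 0) +oo%O &, nondecreasing_fun S}.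
  move=> x y; rewrite !in_itv /= !andbT => x0 y0 xy.
  apply: sup_le; [|exact: (hs _ x0).1|exact: hs].
  move=> z [B1 h1 [B2 h2 ->]]; apply/downP; eexists; last exact: lexx.
  by exists B1; [exact: mono h1|exists B2; [exact: mono h2|]].
have lbS : has_lbound (S @` [set` Interval (BRight 0) +oo%O]).
  by exists 0 => _ [x + <-]; rewrite /= in_itv /= andbT => x0; exact: S0.
have hlim := nondecreasing_at_right_cvgr (erefl : (BRight 0 < +oo)%O) ndS lbS.
have eS : sigma M1 L B = inf (S @` [set` Interval (BRight 0) +oo%O]).
  exact: (cvg_lim _ hlim).
rewrite eS in hc; have [|_ [xi + <-] Sc] := inf_lt _ hc.
  by exists (S 1), 1 => //=; rewrite in_itv /= ltr01.
rewrite /= in_itv /= andbT => xi0; exists (S xi), xi; split => //.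
  by rewrite S0.
move=> B1 B2 h1 h2; rewrite -ler_pdivrMr ?mulr_gt0 ?(pos _ _ _ h1) ?(pos _ _ _ h2) //.
by apply: sup_upper_bound; [exact: hs|exists B1 => //; exists B2].
Qed.

(** Passes from points to tangent vectors: u is realised by y in M1 with P1 (y - B) = t u exactly,
    so that P (y - B) = t P u = 0 puts y in the angle set; v is realised by t v + B. Replacing y - B
    by t u costs an error absorbed between k and c. *)
Lemma sigma_lt_angle (P1 P : {linear E -> E}) (c : R) :
    M1 B -> lin_subspace L -> L B -> orth_projector P1 -> orth_projector P ->
    tangent_at M1 B P1 -> locally_closed M1 B -> (forall u, P (P1 u) = P u) ->
    (forall w, tangent_space (M1 `&` L) B w -> P w = w) ->
    (forall xi, 0 < xi -> angle_set M1 L B M1 xi !=set0 /\ angle_set M1 L B L xi !=set0) ->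
    sigma M1 L B < c ->
  exists2 k, 0 <= k < c & forall u v, P1 u = u -> P u = 0 -> L v -> P v = 0 ->
    frob_dot u v <= k * (frob u * frob v).
Proof.
move=> M1B sL LB oP1 oP hM1 cM1 PP1 hT hne hc.
have [k [xi [/andP[k0 kc] xi0 hk]]] := sigma_lt_angle_bound sL LB hne hc.
have [L0 LD] := sL.
pose k' := (k + c) / 2.
have k'k : k < k' by rewrite /k'; lra.
exists k'; first by rewrite /k'; apply/andP; split; lra.
move=> u v P1u Pu Lv Pv.
have [->|u0] := eqVneq u 0; first by rewrite frob_dot0l frob0 mul0r mulr0.
have [->|v0] := eqVneq v 0; first by rewrite frob_dotC frob_dot0l frob0 !mulr0.
have fpos (w : E) : w != 0 -> 0 < frob w.
  by move=> w0; rewrite lt0r frob_ge0 andbT; apply: contra_neq w0; exact: frob_eq0.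
have up := fpos u u0; have vp := fpos v v0.
(* Solves k + d = k' (1 - d): the chord error enters once through the inner product and once through
   the norm of y - B. *)
pose d := (k' - k) / (1 + k').
have d0 : 0 < d by rewrite divr_gt0; lra.
have dE : d * (1 + k') = k' - k by rewrite /d divfK // lt0r_neq0 //; lra.
have [r1 r10 [hflat _]] := hM1 d d0.
have [r2 r20 hon] := tangent_at_onto M1B oP1 hM1 cM1.
pose r := Num.min (Num.min r1 r2) xi.
have r0 : 0 < r by rewrite !lt_min r10 r20.
have : r <= r by [].
rewrite {2}/r !le_min => /andP[/andP[rr1 rr2] rxi].
pose t := r / (4 * (frob u + frob v)).
have uv0 : 0 < frob u + frob v by rewrite addr_gt0.
have t0 : 0 < t by rewrite divr_gt0 ?mulr_gt0.
have tE : 4 * (t * frob u + t * frob v) = r.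
  by rewrite /t; field; rewrite lt0r_neq0.
have tu0 : 0 < t * frob u by rewrite mulr_gt0.
have tv0 : 0 < t * frob v by rewrite mulr_gt0.
have ftu : frob (t *: u) = t * frob u by rewrite frobZ gtr0_norm.
have ftv : frob (t *: v) = t * frob v by rewrite frobZ gtr0_norm.
have [||y [My Py yB]] := hon (t *: u); first by rewrite linearZ /= P1u.
  by rewrite ftu; lra.
pose w := y - B.
have h1 : angle_set M1 L B M1 xi y.
  split => //.
  - by move=> yE; move: Py tu0; rewrite yE subrr linear0 -ftu => <-; rewrite frob0 ltxx.
  - by rewrite ftu in yB; lra.
  - move=> z /hT <-; rewrite -oP.2 -PP1 Py linearZ /= Pu scaler0.
    exact: frob_dot0l.
have h2 : angle_set M1 L B L xi (t *: v + B).
  split.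
  - exact: LD.
  - move/eqP; rewrite -subr_eq0 addrK => /eqP tv; move: tv0.
    by rewrite -ftv tv frob0 ltxx.
  - by rewrite addrK ftv; lra.
  - move=> z /hT <-; rewrite addrK -oP.2 linearZ /= Pv scaler0.
    exact: frob_dot0l.
have := hk _ _ h1 h2; rewrite addrK ftv frob_dotZr => h3.
have h4 : frob (y - B - t *: u) <= d * frob (y - B).
  rewrite -Py; apply: hflat => //; last by rewrite subrr frob0 ltW.
  by rewrite ftu in yB; lra.
have h5 := frob_dot_le (t *: u - (y - B)) v.
rewrite frob_dotDl frob_dotNl frob_dotZl frob_distC in h5.
have h6 := frob_sub_le (y - B) (t *: u); rewrite ftu in h6.
have h7 : frob_dot (y - B) v <= k * frob (y - B) * frob v.
  by rewrite -(ler_pM2l t0); move: h3; congr (_ <= _); ring.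
have h8 : t * frob_dot u v <= (k + d) * frob (y - B) * frob v.
  have : frob (y - B - t *: u) * frob v <= d * frob (y - B) * frob v.
    by rewrite ler_wpM2r // ltW.
  lra.
have h9 : (k + d) * frob (y - B) <= k' * (t * frob u).
  have kd : k + d = k' * (1 - d) by lra.
  rewrite kd -mulrA ler_wpM2l //; first by rewrite (le_trans k0) // ltW.
  lra.
rewrite -(ler_pM2l t0); apply: (le_trans h8).
have : (k + d) * frob (y - B) * frob v <= k' * (t * frob u) * frob v.
  by rewrite ler_wpM2r // ltW.
by move/le_trans; apply; rewrite le_eqVlt; apply/orP; left; apply/eqP; ring.
Qed.
End Angle.

(** * Charts and tangent spaces *)

Lemma injective_linear_bound {R : realType} {d p q : nat}
    (h : {linear 'rV[R]_d -> 'M[R]_(p, q)}) : injective h ->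
  exists2 K, 0 < K & forall v, `|v| <= K * frob (h v).
Proof.
move=> hinj; pose A := lin1_mx (mxvec \o h).
have hA v : v *m A = mxvec (h v) by rewrite mul_rV_lin1.
have /row_freeP [H AH] : row_free A.
  apply: inj_row_free => v; rewrite hA -(linear0 mxvec) => /(can_inj mxvecK).
  by rewrite -(linear0 h) => /hinj.
exists (frob H + 1); first by rewrite ltr_wpDl ?frob_ge0.
move=> v; have vE : v = mxvec (h v) *m H by rewrite -hA -mulmxA AH mulmx1.
rewrite {1}vE.
apply: (le_trans (normr_le_frob _)); apply: (le_trans (frob_mulmx _ _)).
have -> : frob (mxvec (h v)) = frob (h v).
  congr Num.sqrt; rewrite [RHS]frob_dotE /frob_dot big_ord1.
  rewrite (reindex _ (curry_mxvec_bij _ _)) /=.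
  by apply: eq_bigr => -[i j] _; rewrite !mxvecE.
by rewrite mulrC ler_wpM2r ?frob_ge0 // lerDl.
Qed.

Section Chart.
Context {R : realType} {p q : nat}.
Notation E := 'M[R]_(p, q).

Lemma derive_along_segment (d : nat) (f : 'rV[R]_d -> E) (b v : 'rV[R]_d) (t : R) i j :
  derivable f (b + t *: v) v ->
  is_derive t (1 : R) (fun s : R => f (b + s *: v) i j) ('D_v f (b + t *: v) i j).
Proof.
move=> df; pose g (s : R) := f (b + s *: v).
have e : (fun h : R => h^-1 *: ((g \o shift t) (h *: (1 : R)) - g t)) =
         (fun h => h^-1 *: ((f \o shift (b + t *: v)) (h *: v) - f (b + t *: v))).
  apply/funext => h /=; congr (_ *: (f _ - _)).
  by rewrite [h *: 1]mulr1 scalerDl addrCA.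
have dg : derivable g t (1 : R) by rewrite /derivable e.
have Dg : 'D_(1 : R) g t = 'D_v f (b + t *: v) by rewrite /derive e.
apply: DeriveDef; first by move/derivable_mxP: dg.
by rewrite -Dg derive_mx // mxE.
Qed.

(** The partial derivatives, continuous at x, control all directional derivatives near x uniformly;
    the mean value theorem on the segment from b to a concludes. *)
Lemma C2_strictly_differentiable (d : nat) (U : set 'rV[R]_d) (f : 'rV[R]_d -> E) x :
  open U -> U x -> of_class 2 U f -> forall eta, 0 < eta ->
  exists2 rho, 0 < rho & (forall a, `|a - x| < rho -> U a) /\
    forall a b, `|a - x| < rho -> `|b - x| < rho ->
    `|f a - f b - 'd f x (a - b)| <= eta * `|a - b|.
Proof.
move=> oU Ux [df hD] eta eta0.
have cD v : {for x, continuous ('D_v f)}.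
  by apply: differentiable_continuous; exact: (hD v).1.
pose e i : 'rV[R]_d := delta_mx 0 i.
(* [d.+1] avoids a division by 0; d terms of this size add up to at most eta. *)
have eta1 : 0 < eta / d.+1%:R by rewrite divr_gt0.
have : \forall y \near x, U y /\ forall i, `|'D_(e i) f x - 'D_(e i) f y| < eta / d.+1%:R.
  apply: filterI; first exact: open_nbhs_nbhs.
  have FF : Filter (nbhs x) by exact: nbhs_filter.
  have near_e i : nbhs x [set y | `|'D_(e i) f x - 'D_(e i) f y| < eta / d.+1%:R].
    have /cvgr_dist_lt /(_ _ eta1) h := cD (e i).
    exact: h.
  exact: (@filter_forall _ _
    (fun i => [set y | `|'D_(e i) f x - 'D_(e i) f y| < eta / d.+1%:R]) _ FF near_e).
move=> /nbhs_ballP [rho /= rho0 hrho]; exists rho => //; split.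
  by move=> a ha; have [] := hrho a; rewrite // -ball_normE /= distrC.
have hD' y v : `|y - x| < rho -> derivable f y v /\ `|'D_v f y - 'D_v f x| <= eta * `|v|.
  move=> yx; have [|Uy hy] := hrho y; first by rewrite -ball_normE /= distrC.
  split; first exact/diff_derivable/df.
  have expand z : U z -> 'D_v f z = \sum_k v 0 k *: 'D_(e k) f z.
    move=> Uz; rewrite deriveE; last exact: df.
    rewrite [in LHS](row_sum_delta v) linear_sum /=.
    by apply: eq_bigr => k _; rewrite linearZ /= deriveE //; exact: df.
  have -> : 'D_v f y - 'D_v f x = \sum_k v 0 k *: ('D_(e k) f y - 'D_(e k) f x).
    rewrite (eq_bigr (fun k => v 0 k *: 'D_(e k) f y - v 0 k *: 'D_(e k) f x)).
      by rewrite sumrB; congr (_ - _); exact: expand.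
    by move=> k _; rewrite scalerBr.
  apply: (le_trans (ler_norm_sum _ _ _)).
  apply: (@le_trans _ _ (\sum_(k < d) `|v| * (eta / d.+1%:R))).
    apply: ler_sum => k _; rewrite normrZ ler_pM //.
      by rewrite [leRHS]/Num.Def.normr/= mx_normrE (le_bigmax _ _ (ord0, k)).
    by rewrite distrC ltW.
  rewrite sumr_const card_ord -[leLHS]mulr_natr.
  have -> : `|v| * (eta / d.+1%:R) * d%:R = eta * `|v| * (d%:R / d.+1%:R) by ring.
  rewrite ler_piMr ?mulr_ge0 ?(ltW eta0) // ler_pdivrMr // mul1r ler_nat.
  exact: leqnSn.
move=> a b ax bx; pose v := a - b.
have seg t : 0 <= t <= 1 -> `|b + t *: v - x| < rho.
  move=> /andP[t0 t1].
  have -> : b + t *: v - x = (1 - t) *: (b - x) + t *: (a - x).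
    by apply/matrixP => k l; rewrite /v !mxE; ring.
  apply: (le_lt_trans (ler_normD _ _)); rewrite !normrZ !ger0_norm ?subr_ge0 //.
  pose M := Num.max `|b - x| `|a - x|.
  have hM : M < rho by rewrite gt_max bx ax.
  apply: (le_lt_trans _ hM).
  have h1 : (1 - t) * `|b - x| <= (1 - t) * M by rewrite ler_wpM2l ?subr_ge0 // le_max lexx.
  have h2 : t * `|a - x| <= t * M by rewrite ler_wpM2l // le_max lexx orbT.
  lra.
rewrite -(deriveE _ (df x Ux)) -/v.
rewrite [leLHS]/Num.Def.normr/= mx_normrE bigmax_le ?mulr_ge0 ?(ltW eta0) // => -[i j] _ /=.
(* The sup norm reduces the claim to single entries, each with its own intermediate point. *)
pose phi (s : R) : R := f (b + s *: v) i j.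
pose dphi (s : R) : R := 'D_v f (b + s *: v) i j.
have hd (t : R) : t \in `[0, 1]%R -> is_derive t (1 : R) phi (dphi t).
  rewrite in_itv /= => /seg tx; apply: derive_along_segment.
  exact: (hD' _ v tx).1.
have hd1 (t : R) : t \in `]0, 1[%R -> is_derive t (1 : R) phi (dphi t).
  by rewrite in_itv /= => /andP[t0 t1]; apply: hd; rewrite in_itv /= !ltW.
have cphi : {within `[0, 1], continuous phi}.
  apply: derivable_within_continuous => t t01.
  by have := hd t t01 => -[].
have [t t01] := @MVT R phi dphi 0 1 ltr01 hd1 cphi.
rewrite subr0 mulr1 /phi /dphi scale1r scale0r addr0 [b + v]addrC subrK => ft.
have t1 : 0 <= t <= 1.
  by move: t01; rewrite in_itv /= => /andP[/ltW -> /ltW ->].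
have := (hD' _ v (seg t t1)).2; apply: le_trans.
rewrite [leRHS]/Num.Def.normr/= mx_normrE.
apply: (le_trans _ (le_bigmax _ _ (i, j))) => /=.
by rewrite !mxE -ft.
Qed.

(** Chords and steps are read in the parameter space. Injectivity of the differential bounds the
    parameter difference by the chord, and continuity of the inverse chart keeps parameters near
    x. *)
Lemma chart_tangent_at (M : set E) (B : E) (d : nat) (U : set 'rV[R]_d) f x :
    chart_at M B U f x ->
  exists P : {linear E -> E}, [/\ orth_projector P, tangent_at M B P,
    forall u, range ('d f x) (P u) & forall v, P ('d f x v) = 'd f x v].
Proof.
move=> [[oU Ux fx cU dinj] [W [g [oW fU gf cg]]]].
have [P [hP PS SP]] : exists P : {linear E -> E}, [/\ orth_projector P,
    (forall u, range ('d f x) (P u)) & (forall u, range ('d f x) u -> P u = u)].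
  apply: orth_projector_exists; split; first by exists 0 => //; rewrite linear0.
  by move=> a _ _ [v _ <-] [v' _ <-]; exists (a *: v + v') => //; rewrite linearP.
have Pd v : P ('d f x v) = 'd f x v by apply: SP; exists v.
exists P; split => // dl dl0.
have [K K0 hK] := injective_linear_bound (dinj x Ux).
pose N : R := (p * q)%:R + 1.
have N0 : 0 < N by rewrite ltr_wpDl.
have hN (u : E) : frob u <= N * `|u|.
  by apply: (le_trans (frob_le_normr _)); rewrite ler_wpM2r // lerDl.
pose h := Num.min (1 / 2) (dl / 2).
have h0 : 0 < h by rewrite lt_min; apply/andP; split; lra.
have h1 : h <= 1 / 2 by rewrite ge_min lexx.
have h2 : h <= dl / 2 by rewrite ge_min lexx orbT.
(* N converts the sup norm into [frob] and K is the injectivity bound: the error e of a chord with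
   parameter difference v satisfies K |e| <= h |v|. *)
have eta0 : 0 < h / (K * N) by rewrite divr_gt0 // mulr_gt0.
have [r1 r10 [rU hstr]] := C2_strictly_differentiable oU Ux cU eta0.
have strict a b : `|a - x| < r1 -> `|b - x| < r1 ->
    K * frob (f a - f b - 'd f x (a - b)) <= h * `|a - b|.
  move=> ar br; apply: (le_trans (ler_wpM2l (ltW K0) (hN _))).
  rewrite mulrA -ler_pdivlMl ?mulr_gt0 //; apply: (le_trans (hstr _ _ ar br)).
  by rewrite [h / _]mulrC -mulrA.
have inM a : U a -> M (f a).
  by move=> Ua; have [] : (M `&` W) (f a) by rewrite -fU; exists a.
have WB : (M `&` W) B by rewrite -fU; exists x.
have [r2 r20 hg] : exists2 r, 0 < r & forall y, M y -> frob (y - B) < r ->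
    exists a, [/\ U a, f a = y & `|a - x| < r1 / 2].
  have gx : g B = x by rewrite -fx gf.
  have r1h : 0 < r1 / 2 by rewrite divr_gt0.
  have cgB : g @ within (M `&` W) (nbhs B) --> g B.
    by have /subspace_continuousP := cg; exact.
  have : nbhs B [set y | (M `&` W) y -> `|x - g y| < r1 / 2].
    by rewrite -gx; have /cvgr_dist_lt /(_ _ r1h) := cgB.
  move=> /nbhs_ballP [s1 /= s10 hs1].
  have /nbhs_ballP [s2 /= s20 hs2] : nbhs B W.
    by apply: open_nbhs_nbhs; split => //; exact: WB.2.
  exists (Num.min s1 s2); first by rewrite lt_min s10.
  move=> y My; rewrite lt_min => /andP[y1 y2].
  have yball s : frob (y - B) < s -> ball B s y.
    by move=> ys; rewrite -ball_normE /= distrC; exact: le_lt_trans (normr_le_frob _) ys.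
  have Wy : W y by apply: hs2; exact: yball.
  have [a Ua fa] : (f @` U) y by rewrite fU.
  exists a; split => //; rewrite distrC -(gf a Ua) fa.
  exact: (hs1 y (yball _ y1) (conj My Wy)).
have KD v : `|v| <= K * frob ('d f x v) by exact: hK.
have r12 : r1 / 2 < r1 by lra.
exists (Num.min (r2 / 2) (r1 / (4 * K))).
  by rewrite lt_min !divr_gt0 // mulr_gt0.
split.
  move=> y z My Mz; rewrite !le_min => /andP[y1 _] /andP[z1 _].
  have [|a [Ua fa ax]] := hg y My; first lra.
  have [|b [Ub fb bx]] := hg z Mz; first lra.
  have h3 := strict a b (lt_trans ax r12) (lt_trans bx r12).
  rewrite fa fb in h3.
  have [v [e [yz {}h3]]] : exists v e, y - z = 'd f x v + e /\ K * frob e <= h * `|v|.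
    exists (a - b), (y - z - 'd f x (a - b)); split => //.
    by move: (y - z) ('d f x (a - b)) => u w; rewrite addrC subrK.
  have v0 : 0 <= `|v| by [].
  have vK := KD v; have e0 := frob_ge0 e.
  have h4 : frob ('d f x v) <= frob (y - z) + frob e.
    have -> : 'd f x v = (y - z) - e by rewrite yz addrK.
    by apply: (le_trans (frob_triangle _ _)); rewrite frobN.
  have h5 : K * frob ('d f x v) <= K * frob (y - z) + K * frob e.
    by rewrite -mulrDr ler_wpM2l // ltW.
  have hv : h * `|v| <= 1 / 2 * `|v| by rewrite ler_wpM2r.
  have h6 : `|v| <= 2 * (K * frob (y - z)) by lra.
  have -> : y - z - P (y - z) = e - P e.
    by rewrite yz linearD /= Pd opprD addrACA subrr add0r.
  apply: (le_trans (orth_projectorC_le _ hP)).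
  rewrite -(ler_pM2l K0); apply: (le_trans h3).
  have : h * `|v| <= h * (2 * (K * frob (y - z))) by rewrite ler_wpM2l // ltW.
  move/le_trans; apply.
  have : h * (K * frob (y - z)) <= dl / 2 * (K * frob (y - z)).
    by rewrite ler_wpM2r // mulr_ge0 ?frob_ge0 // ltW.
  lra.
move=> z t Mz; rewrite !le_min => /andP[z1 _] Pt /andP[_ t1].
have [|b [Ub fb bx]] := hg z Mz; first lra.
have [v _ vt] := PS t; rewrite Pt in vt.
have vr : `|v| <= r1 / 4.
  apply: (le_trans (KD v)); rewrite vt.
  apply: (le_trans (ler_wpM2l (ltW K0) t1)).
  rewrite le_eqVlt; apply/orP; left; apply/eqP; field.
  by rewrite lt0r_neq0.
have bvx : `|b + v - x| < r1.
  by rewrite addrAC; apply: (le_lt_trans (ler_normD _ _)); lra.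
have h3 := strict (b + v) b bvx (lt_trans bx r12).
exists (f (b + v)); first exact/inM/rU.
have bv : b + v - b = v by rewrite addrAC subrr add0r.
rewrite bv fb vt in h3.
rewrite -(ler_pM2l K0); apply: (le_trans h3).
have h4 : h * `|v| <= h * (K * frob t).
  by rewrite ler_wpM2l ?(ltW h0) // -vt.
apply: (le_trans h4); rewrite mulrCA ler_wpM2l ?(ltW K0) // ler_wpM2r ?frob_ge0 //.
lra.
Qed.

(* Curves in M issued from B stay within o(t) of the range of the projector. *)
Lemma tangent_space_projector (M M' : set E) (B : E) (P : {linear E -> E}) w :
  M `<=` M' -> M' B -> orth_projector P -> tangent_at M' B P ->
  tangent_space M B w -> P w = w.
Proof.
move=> MM' M'B hP hM [d [U [f [x [[[oU Ux fx cU _] [W [g [oW fU _ _]]]] [v _ <-]]]]]].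
have inM a : U a -> M' (f a).
  by move=> Ua; apply: MM'; have [] : (M `&` W) (f a) by rewrite -fU; exists a.
have wE : forall k, 'd f x (k *: v) = k *: 'd f x v by move=> k; rewrite linearZ.
move: ('d f x v) wE => w0 wE; apply/esym/eqP; rewrite -subr_eq0; apply/eqP/frob_eq0.
apply: le_anti; rewrite frob_ge0 andbT; apply/ler_addgt0Pl => e e0; rewrite addr0.
have w0p := frob_ge0 w0; have v0 : 0 <= `|v| by [].
pose N : R := (p * q)%:R + 1.
have N0 : 0 < N by rewrite ltr_wpDl.
have hN (u : E) : frob u <= N * `|u|.
  by apply: (le_trans (frob_le_normr _)); rewrite ler_wpM2r // lerDl.
pose e1 := Num.min 1 (e / 4).
have e10 : 0 < e1 by rewrite lt_min ltr01 divr_gt0.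
have e11 : e1 <= 1 by rewrite ge_min lexx.
have e14 : e1 <= e / 4 by rewrite ge_min lexx orbT.
have dl0 : 0 < e / (4 * (frob w0 + 1)) by rewrite divr_gt0 // mulr_gt0 // ltr_wpDl.
have dlE : e / (4 * (frob w0 + 1)) * (frob w0 + 1) = e / 4.
  by field; rewrite lt0r_neq0 // ltr_wpDl.
move: (e / (4 * (frob w0 + 1))) dl0 dlE => dl dl0 dlE.
have [r1 r10 [hflat _]] := hM dl dl0.
have eta0 : 0 < e1 / (N * (`|v| + 1)) by rewrite divr_gt0 // mulr_gt0 // ltr_wpDl.
have [r2 r20 [rU hstr]] := C2_strictly_differentiable oU Ux cU eta0.
pose r := Num.min r1 r2.
have r0 : 0 < r by rewrite lt_min r10.
have rr1 : r <= r1 by rewrite ge_min lexx.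
have rr2 : r <= r2 by rewrite ge_min lexx orbT.
(* Small enough to keep the parameter x + k v within r2 of x and its image within r1 of B. *)
pose k := r / (2 * (frob w0 + 1 + `|v|)).
have S0 : 0 < frob w0 + 1 + `|v| by rewrite ltr_wpDr // ltr_wpDl.
have k0 : 0 < k by rewrite divr_gt0 // mulr_gt0.
have kE : 2 * (k * frob w0 + k + k * `|v|) = r by rewrite /k; field; rewrite lt0r_neq0.
have kw : 0 <= k * frob w0 by rewrite mulr_ge0 // ltW.
have kv : 0 <= k * `|v| by rewrite mulr_ge0 // ltW.
have xx : `|x - x| < r2 by rewrite subrr normr0.
have kx : `|x + k *: v - x| < r2.
  by rewrite addrAC subrr add0r normrZ gtr0_norm //; lra.
have := hstr _ _ kx xx; rewrite fx [x + _ - x]addrAC subrr add0r wE normrZ gtr0_norm //.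
set y := f (x + k *: v) => h1.
have h2 : frob (y - B - k *: w0) <= k * e1.
  apply: (le_trans (hN _)); apply: (le_trans (ler_wpM2l (ltW N0) h1)).
  have -> : N * (e1 / (N * (`|v| + 1)) * (k * `|v|)) = k * e1 * (`|v| / (`|v| + 1)).
    by field; rewrite !lt0r_neq0 // ltr_wpDl.
  have q1 : `|v| / (`|v| + 1) <= 1 by rewrite ler_pdivrMr ?ltr_wpDl // mul1r lerDl.
  by rewrite ler_piMr // mulr_ge0 // ltW.
have fkw : frob (k *: w0) = k * frob w0 by rewrite frobZ gtr0_norm.
have h3 := frob_sub_le (y - B) (k *: w0); rewrite fkw in h3.
have ke1 : k * e1 <= k by rewrite ler_piMr // ltW.
have h4 : frob (y - B - P (y - B)) <= dl * frob (y - B).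
  by apply: hflat => //; [exact/inM/rU|lra|rewrite subrr frob0 ltW].
have h5 : frob (k *: w0 - P (k *: w0)) <= dl * frob (y - B) + k * e1.
  have -> : k *: w0 - P (k *: w0) = (y - B - P (y - B)) -
      ((y - B - k *: w0) - P (y - B - k *: w0)).
    rewrite (linearB P (y - B)) /=; move: (y - B) (P (y - B)) (P (k *: w0)) => a b c.
    by apply/matrixP => i j; rewrite !mxE; ring.
  apply: (le_trans (frob_triangle _ _)); rewrite frobN lerD //.
  exact: (le_trans (orth_projectorC_le _ hP)).
rewrite linearZ /= -scalerBr frobZ gtr0_norm // in h5.
have h6 : dl * frob (y - B) <= dl * (k * (frob w0 + 1)).
  by rewrite ler_wpM2l // ?(ltW dl0) //; lra.
rewrite -(ler_pM2l k0).
have ke : k * e1 <= k * (e / 4) by rewrite ler_wpM2l // ltW.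
have dk : dl * (k * (frob w0 + 1)) = k * (e / 4) by rewrite -dlE; ring.
have k4 : 0 < k * e by rewrite mulr_gt0.
lra.
Qed.

End Chart.

(** * The real representation *)

Section RealRep.
Context {R : realType}.

Definition qscale {m n} (a : R) (A : 'M[quat R]_(m, n)) : 'M[quat R]_(m, n) :=
  map_mx (fun x => Quat (a * qre x) (a * qi x) (a * qj x) (a * qk x)) A.

Lemma realrepD {m n} (A B : 'M[quat R]_(m, n)) :
  realrep (A + B) = realrep A + realrep B.
Proof.
have e (f : quat R -> R) : (forall x y, f (x + y) = f x + f y) ->
    map_mx f (A + B) = map_mx f A + map_mx f B.
  by move=> fD; apply/matrixP => i j; rewrite !mxE fD.
by rewrite /realrep !e // !opprD !add_block_mx.
Qed.

Lemma realrepZ {m n} a (A : 'M[quat R]_(m, n)) : realrep (qscale a A) = a *: realrep A.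
Proof.
have e (f : quat R -> R) :
    (forall x, f (Quat (a * qre x) (a * qi x) (a * qj x) (a * qk x)) = a * f x) ->
    map_mx f (qscale a A) = a *: map_mx f A.
  by move=> fD; apply/matrixP => i j; rewrite !mxE fD.
by rewrite /realrep !e // -!scalerN !scale_block_mx.
Qed.

Lemma realrep0 {m n} : realrep (0 : 'M[quat R]_(m, n)) = 0.
Proof. by apply: (addrI (realrep (0 : 'M[quat R]_(m, n)))); rewrite -realrepD !addr0. Qed.

Lemma realrepN {m n} (A : 'M[quat R]_(m, n)) : realrep (- A) = - realrep A.
Proof. by apply: (addrI (realrep A)); rewrite -realrepD !subrr realrep0. Qed.

Lemma realrepB {m n} (A B : 'M[quat R]_(m, n)) :
  realrep (A - B) = realrep A - realrep B.
Proof. by rewrite realrepD realrepN. Qed.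

Lemma realrep_inj {m n} : injective (@realrep R m n).
Proof.
move=> A B /eq_block_mx [/eq_block_mx [eA0 _ eA1 _] _ /eq_block_mx [eA2 eA3 _ _] _].
apply/matrixP => i j; move/matrixP/(_ i j): eA0; move/matrixP/(_ i j): eA1.
move/matrixP/(_ i j): eA2; move/matrixP/(_ i j): eA3; rewrite !mxE.
by case: (A i j) (B i j) => ? ? ? ? [? ? ? ?] /= -> -> -> ->.
Qed.

Lemma realrep_mul {m n s} (A : 'M[quat R]_(m, n)) (B : 'M[quat R]_(n, s)) :
  realrep (A *m B) = realrep A *m realrep B.
Proof.
pose A0 := map_mx (@qre R) A; pose A1 := map_mx (@qi R) A.
pose A2 := map_mx (@qj R) A; pose A3 := map_mx (@qk R) A.
pose B0 := map_mx (@qre R) B; pose B1 := map_mx (@qi R) B.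
pose B2 := map_mx (@qj R) B; pose B3 := map_mx (@qk R) B.
have e0 : map_mx (@qre R) (A *m B) = A0 *m B0 - A1 *m B1 - A2 *m B2 - A3 *m B3.
  apply/matrixP => i j; rewrite !mxE (big_morph (@qre R) (id1 := 0) (op1 := +%R)) //.
  rewrite -!sumrB; apply: eq_bigr => k _; by rewrite !mxE.
have e1 : map_mx (@qi R) (A *m B) = A0 *m B1 + A1 *m B0 + A2 *m B3 - A3 *m B2.
  apply/matrixP => i j; rewrite !mxE (big_morph (@qi R) (id1 := 0) (op1 := +%R)) //.
  rewrite -!big_split -!sumrB; apply: eq_bigr => k _; by rewrite !mxE.
have e2 : map_mx (@qj R) (A *m B) = A0 *m B2 - A1 *m B3 + A2 *m B0 + A3 *m B1.
  apply/matrixP => i j; rewrite !mxE (big_morph (@qj R) (id1 := 0) (op1 := +%R)) //.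
  rewrite -!sumrB -!big_split; apply: eq_bigr => k _; by rewrite !mxE.
have e3 : map_mx (@qk R) (A *m B) = A0 *m B3 + A1 *m B2 - A2 *m B1 + A3 *m B0.
  apply/matrixP => i j; rewrite !mxE (big_morph (@qk R) (id1 := 0) (op1 := +%R)) //.
  rewrite -!big_split -!sumrB -!big_split; apply: eq_bigr => k _; by rewrite !mxE.
rewrite /realrep /= e0 e1 e2 e3 -/A0 -/A1 -/A2 -/A3 -/B0 -/B1 -/B2 -/B3.
rewrite !mulmx_block !add_block_mx !mulmxN !mulNmx ?mulmxN ?opprK.
clear e0 e1 e2 e3.
move: (A0 *m B0) (A0 *m B1) (A0 *m B2) (A0 *m B3) => a00 a01 a02 a03.
move: (A1 *m B0) (A1 *m B1) (A1 *m B2) (A1 *m B3) => a10 a11 a12 a13.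
move: (A2 *m B0) (A2 *m B1) (A2 *m B2) (A2 *m B3) => a20 a21 a22 a23.
move: (A3 *m B0) (A3 *m B1) (A3 *m B2) (A3 *m B3) => a30 a31 a32 a33.
have block_eq m1 m2 n1 n2 (x x' : 'M[R]_(m1, n1)) (y y' : 'M[R]_(m1, n2))
    (z z' : 'M[R]_(m2, n1)) (t t' : 'M[R]_(m2, n2)) :
    x = x' -> y = y' -> z = z' -> t = t' -> block_mx x y z t = block_mx x' y' z' t'.
  by move=> -> -> -> ->.
by apply: (block_eq); apply: block_eq; apply/matrixP => i j; rewrite !mxE; ring.
Qed.

Lemma frob_dot_block {m1 m2 n1 n2} (A A' : 'M[R]_(m1, n1)) (B B' : 'M[R]_(m1, n2))
    (C C' : 'M[R]_(m2, n1)) (D D' : 'M[R]_(m2, n2)) :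
  frob_dot (block_mx A B C D) (block_mx A' B' C' D') =
  frob_dot A A' + frob_dot B B' + (frob_dot C C' + frob_dot D D').
Proof.
rewrite /frob_dot big_split_ord /= -!big_split; congr (_ + _); apply: eq_bigr => i _ /=;
  rewrite big_split_ord /=; congr (_ + _); apply: eq_bigr => j _;
  by rewrite ?(block_mxEul, block_mxEur, block_mxEdl, block_mxEdr).
Qed.

(** Each of the four components fills four blocks, so squared norms are multiplied by 4. *)
Lemma frob_realrep {m n} (A : 'M[quat R]_(m, n)) : frob (realrep A) = 2 * qnorm A.
Proof.
rewrite /frob /realrep !frob_dot_block !(frob_dotNl, frob_dotNr, opprK).
have -> (x y z t : R) : x + y + (y + x) + (z + t + (t + z)) +
    (z + t + (t + z) + (x + y + (y + x))) = 2 ^+ 2 * (x + y + z + t) by ring.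
rewrite sqrtrM ?sqr_ge0 // sqrtr_sqr ger0_norm //; congr (_ * Num.sqrt _).
rewrite /frob_dot -!big_split; apply: eq_bigr => i _ /=.
by rewrite -!big_split; apply: eq_bigr => j _ /=; rewrite !mxE !expr2.
Qed.

End RealRep.

(** * Quaternion rank *)

Section QuaternionRank.
Context {R : realType}.

Definition right_injective {m n} (A : 'M[quat R]_(m, n)) : Prop :=
  forall a : 'cV[quat R]_n, A *m a = 0 -> a = 0.

(** This real column lists the coordinates of a. It identifies quaternion columns with real columns
    of length 4 n, on which A acts as [realrep A]. *)
Lemma realrep_first_col {n} (a : 'cV[quat R]_n) :
  lsubmx (lsubmx (realrep a)) =
  col_mx (col_mx (map_mx (@qre R) a) (map_mx (@qi R) a))
         (col_mx (map_mx (@qj R) a) (map_mx (@qk R) a)).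
Proof.
rewrite /realrep [block_mx (block_mx _ _ _ _) _ _ _]block_mxEh row_mxKl.
by rewrite !block_mxEh -/(block_mx _ _ _ _) block_mxEh row_mxKl.
Qed.

Lemma realrep_first_col_surj {n} (x : 'cV[R]_(n + n + (n + n))) :
  exists a : 'cV[quat R]_n, lsubmx (lsubmx (realrep a)) = x.
Proof.
exists (\col_i Quat (usubmx (usubmx x) i 0) (dsubmx (usubmx x) i 0)
                    (usubmx (dsubmx x) i 0) (dsubmx (dsubmx x) i 0)).
rewrite realrep_first_col -[x in RHS]vsubmxK -[usubmx x in RHS]vsubmxK.
rewrite -[dsubmx x in RHS]vsubmxK.
by congr (col_mx (col_mx _ _) (col_mx _ _)); apply/matrixP => i j; rewrite [j]ord1 !mxE.
Qed.

Lemma realrep_first_col_eq0 {n} (a : 'cV[quat R]_n) :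
  lsubmx (lsubmx (realrep a)) = 0 -> a = 0.
Proof.
rewrite realrep_first_col -!col_mx0 => /eq_col_mx [/eq_col_mx [a0 a1] /eq_col_mx [a2 a3]].
apply/matrixP => i j; move/matrixP/(_ i j): a0; move/matrixP/(_ i j): a1.
move/matrixP/(_ i j): a2; move/matrixP/(_ i j): a3; rewrite !mxE.
by case: (a i j) => ? ? ? ? /= -> -> -> ->.
Qed.

(** The kernels of A and of [realrep A] correspond through first columns. H may be any real matrix;
    it makes right independence accessible to norm estimates. *)
Lemma right_injective_left_inverse {m n} (A : 'M[quat R]_(m, n)) :
  right_injective A <-> exists H, H *m realrep A = 1%:M.
Proof.
split=> [hA|[H HA] a Aa]; last first.
  apply: realrep_inj; rewrite realrep0 -[LHS]mul1mx -HA -mulmxA -realrep_mul Aa.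
  by rewrite realrep0 mulmx0.
have /row_freeP [K AK] : row_free (realrep A)^T.
  apply: inj_row_free => v; rewrite -{1}(trmxK v) -trmx_mul => /(congr1 trmx).
  rewrite trmxK trmx0 => Av.
  have [a av] := realrep_first_col_surj v^T.
  suff a0 : a = 0.
    rewrite -(trmxK v) -av a0 realrep0; apply/matrixP => i j; by rewrite !mxE.
  apply: hA; apply: realrep_first_col_eq0.
  by rewrite realrep_mul -!mulmx_lsub av Av.
exists K^T; apply: trmx_inj; rewrite trmx_mul trmxK.
by rewrite AK trmx1.
Qed.

Lemma right_freeP {m n} (A : 'M[quat R]_(m, n)) (J : {set 'I_n}) :
  right_free A J <-> right_injective (colsub (@enum_val _ (mem J)) A).
Proof.
split=> [hJ b hb|hJ a ha j jJ].
  pose a j := \sum_(k | enum_val k == j) b k 0.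
  have aE k : a (@enum_val _ (mem J) k) = b k 0.
    rewrite /a (eq_bigl (pred1 k)) ?big_pred1_eq // => l /=.
    exact: (inj_eq enum_val_inj).
  apply/matrixP => k l; rewrite [l]ord1 [RHS]mxE -aE; apply: hJ (enum_valP k) => i.
  rewrite big_enum_val /=; move/matrixP/(_ i 0): hb; rewrite !mxE => hb; rewrite -[RHS]hb.
  by apply: eq_bigr => t _; rewrite aE !mxE.
pose b : 'cV[quat R]_#|J| := \col_k a (enum_val k).
have b0 : b = 0.
  apply: hJ; apply/matrixP => i l; rewrite [l]ord1 !mxE -[RHS](ha i) [RHS]big_enum_val.
  by apply: eq_bigr => k _; rewrite !mxE.
by move/matrixP/(_ (enum_rank_in jJ j) 0): b0; rewrite !mxE enum_rankK_in.
Qed.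

Lemma qrank_geP {m n} (A : 'M[quat R]_(m, n)) k :
  (k <= qrank A)%N <-> exists2 J, right_free A J & (k <= #|J|)%N.
Proof.
split=> [kA|[J hJ kJ]]; last first.
  apply: (leq_trans kJ); rewrite /qrank.
  by apply: (leq_bigmax_cond (F := fun J : {set 'I_n} => #|J|)); apply/asboolP.
have : (0 < #|[pred J : {set 'I_n} | `[< right_free A J >]]|)%N.
  apply/card_gt0P; exists finset.set0; apply/asboolP => a _ j; by rewrite finset.in_set0.
move=> /(eq_bigmax_cond (fun J : {set 'I_n} => #|J|)) [J hJ e].
by exists J; [apply/asboolP|rewrite -e].
Qed.

(** If the columns J of A' kill a, then a = H (A - A') S a, where H is a left inverse of the columns
    J of A and S selects columns; for A' near A this is a strict contraction, so a = 0. *)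
Lemma right_free_open {m n} (A : 'M[quat R]_(m, n)) J : right_free A J ->
  exists2 rho, 0 < rho & forall A' : 'M[quat R]_(m, n),
    frob (realrep A' - realrep A) < rho -> right_free A' J.
Proof.
move=> /right_freeP /right_injective_left_inverse [H HA].
pose S : 'M[quat R]_(n, #|J|) := colsub (@enum_val _ (mem J)) 1%:M.
have colE (X : 'M[quat R]_(m, n)) : colsub (@enum_val _ (mem J)) X = X *m S.
  by rewrite mulmx_colsub mulmx1.
pose K := frob H * frob (realrep S) + 1.
have K0 : 0 < K by rewrite ltr_wpDl // mulr_ge0 ?frob_ge0.
exists K^-1; first by rewrite invr_gt0.
move=> A' hA'; apply/right_freeP => a; rewrite colE => ha.
apply: realrep_inj; rewrite realrep0; apply: frob_eq0.
have e : realrep a = H *m (realrep A - realrep A') *m realrep S *m realrep a.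
  rewrite -[LHS]mul1mx -HA colE !realrep_mul mulmxBr !mulmxBl !mulmxA.
  by rewrite -!(mulmxA H) -!realrep_mul ha realrep0 mulmx0 subr0.
have a0 := frob_ge0 (realrep a).
have h : frob (realrep a) <=
    frob H * frob (realrep A - realrep A') * frob (realrep S) * frob (realrep a).
  rewrite {1}e; apply: (le_trans (frob_mulmx _ _)); rewrite ler_wpM2r //.
  apply: (le_trans (frob_mulmx _ _)); rewrite ler_wpM2r ?frob_ge0 //.
  exact: frob_mulmx.
apply/eqP; apply: contraT => an0; have ap : 0 < frob (realrep a) by rewrite lt0r an0.
rewrite -[leLHS]mul1r ler_pM2r // frob_distC in h.
have : K * frob (realrep A' - realrep A) < 1 by rewrite -ltr_pdivlMl // mulr1.
have := frob_ge0 (realrep A' - realrep A); rewrite /K; lra.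
Qed.

Lemma qrank_open {m n} (A : 'M[quat R]_(m, n)) :
  exists2 rho, 0 < rho & forall A' : 'M[quat R]_(m, n),
    frob (realrep A' - realrep A) < rho -> (qrank A <= qrank A')%N.
Proof.
have [J hJ AJ] := (qrank_geP A _).1 (leqnn _).
have [rho rho0 h] := right_free_open hJ; exists rho => // A' /h hJ'.
by apply/qrank_geP; exists J.
Qed.

Lemma qrank_mul_le {m n r} (C : 'M[quat R]_(m, r)) (F : 'M[quat R]_(r, n)) :
  (qrank (C *m F) <= r)%N.
Proof.
have [J hJ CJ] := (qrank_geP (C *m F) _).1 (leqnn _); apply: (leq_trans CJ).
have : right_injective (colsub (@enum_val _ (mem J)) F).
  move=> a Fa; apply: ((right_freeP _ _).1 hJ).
  by rewrite -mulmx_colsub -mulmxA Fa mulmx0.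
(* Comparing the sizes of the real matrices gives 4 #|J| <= 4 r. *)
move=> /right_injective_left_inverse [H /mulmx1_min].
by rewrite !addnn !leq_double.
Qed.

Lemma quat_inverse (x : quat R) : x != 0 -> exists y, x * y = 1.
Proof.
case: x => a b c d x0; pose N := a ^+ 2 + b ^+ 2 + c ^+ 2 + d ^+ 2.
have N0 : N != 0.
  apply: contra x0; rewrite /N !paddr_eq0 ?addr_ge0 ?sqr_ge0 // !sqrf_eq0.
  by case/andP => /andP [/andP [/eqP -> /eqP ->] /eqP ->] /eqP ->.
exists (Quat (a / N) (- b / N) (- c / N) (- d / N)).
have NV : N / N = 1 by rewrite divff.
by congr Quat; rewrite /= ?[in RHS]/= -?NV /N; ring.
Qed.

(** By maximality of J, a column j outside J enters a dependence relation. Its coefficient is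
    nonzero since J is free, and a right inverse of it solves the relation for column j. *)
Lemma qrank_factor {m n} (A : 'M[quat R]_(m, n)) J :
  right_free A J -> qrank A = #|J| ->
  exists F, A = colsub (@enum_val _ (mem J)) A *m F.
Proof.
move=> hJ rA.
have col j : exists f : 'I_#|J| -> quat R,
    forall i, A i j = \sum_k A i (enum_val k) * f k.
  have [jJ|jJ] := boolP (j \in J).
    exists (fun k => if k == enum_rank_in jJ j then 1 else 0) => i.
    rewrite (bigD1 (enum_rank_in jJ j)) //= eqxx mulr1 enum_rankK_in //.
    by rewrite big1 ?addr0 // => k /negbTE ->; rewrite mulr0.
  have : ~ right_free A (j |: J).
    move=> h; have : (#|J|.+1 <= qrank A)%N.
      by apply/qrank_geP; exists (j |: J) => //; rewrite cardsU1 jJ.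
    by rewrite rA ltnn.
  move=> /existsNP [a /not_implyP [ha /existsNP [l /not_implyP [lJ al]]]].
  have aj0 : a j != 0.
    apply/eqP => aj; apply: al.
    have hJa : forall i, \sum_(k in J) A i k * a k = 0.
      by move=> i; rewrite -[RHS](ha i) big_setU1 //= aj mulr0 add0r.
    by move: lJ; rewrite in_setU1 => /predU1P [->//|]; exact: hJ.
  have [y ay] := quat_inverse aj0.
  exists (fun k => - (a (enum_val k) * y)) => i.
  have := ha i; rewrite big_setU1 //= big_enum_val /= => /eqP.
  rewrite addr_eq0 => /eqP e; rewrite -[LHS]mulr1 -ay mulrA e mulNr mulr_suml -sumrN.
  by apply: eq_bigr => k _; rewrite mulrN mulrA.
have [F hF] := choice col.
exists (\matrix_(k, j) F j k); apply/matrixP => i j; rewrite !mxE hF.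
by apply: eq_bigr => k _; rewrite !mxE.
Qed.

End QuaternionRank.

(** * The manifold of matrices of rank r *)

Section MatrixFactorization.
Context {R : realType} {p q k : nat}.
Implicit Types (H : 'M[R]_(k, p)) (S : 'M[R]_(q, k)) (b y z : 'M[R]_(p, q)).

(** As H inverts the selected columns of b, w = psi - chi equals H (y - z) - H (y - b) S w - H (y -
    z) S chi; the middle term is at most half of w and is absorbed. *)
Lemma factor_lipschitz H S b y z (psi chi : 'M[R]_(k, q)) :
  H *m (b *m S) = 1%:M -> y = y *m S *m psi -> z = z *m S *m chi ->
  frob H * frob S * frob (y - b) <= 1 / 2 ->
  frob (psi - chi) <= 2 * (frob H + frob H * frob S * frob chi) * frob (y - z).
Proof.
move=> HbS ey ez hy; set w := psi - chi.
have e : w = H *m (y - z) - H *m ((y - b) *m S) *m w - H *m ((y - z) *m S) *m chi.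
  rewrite /w; have -> : H *m (y - z) = H *m (y *m S) *m psi - H *m (z *m S) *m chi.
    by rewrite {1}ey {1}ez mulmxBr !mulmxA.
  rewrite (mulmxBl y b) (mulmxBr H) HbS (mulmxBl y z) (mulmxBr H).
  move: (H *m (y *m S)) (H *m (z *m S)) => Y Z.
  rewrite !mulmxBl !mulmxBr !mul1mx.
  move: (Y *m psi) (Y *m chi) (Z *m chi) => u1 u2 u3.
  by apply/matrixP => i j; rewrite !mxE; ring.
have H0 := frob_ge0 H; have w0 := frob_ge0 w.
have n1 := frob_mulmx H (y - z).
have n2 : frob (H *m ((y - b) *m S) *m w) <= frob H * frob S * frob (y - b) * frob w.
  apply: (le_trans (frob_mulmx _ _)); rewrite ler_wpM2r // mulrAC -mulrA.
  by apply: (le_trans (frob_mulmx _ _)); rewrite ler_wpM2l // frob_mulmx.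
have n3 : frob (H *m ((y - z) *m S) *m chi) <= frob H * frob S * frob chi * frob (y - z).
  rewrite mulrAC [_ * frob S * _]mulrAC -(mulrA (frob H)).
  apply: (le_trans (frob_mulmx _ _)); rewrite ler_wpM2r ?frob_ge0 //.
  by apply: (le_trans (frob_mulmx _ _)); rewrite ler_wpM2l // frob_mulmx.
have n4 : frob w <= frob (H *m (y - z)) + frob (H *m ((y - b) *m S) *m w) +
    frob (H *m ((y - z) *m S) *m chi).
  rewrite {1}e; apply: (le_trans (frob_triangle _ _)); rewrite frobN lerD2r.
  by apply: (le_trans (frob_triangle _ _)); rewrite frobN.
have n5 : frob H * frob S * frob (y - b) * frob w <= 1 / 2 * frob w by rewrite ler_wpM2r.
lra.
Qed.

(** Remainder of a chord of the product map relative to its differential at (c, phi): each term is a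
    chord of one factor times a small deviation of the other. *)
Lemma factor_chord (Y Z c : 'M[R]_(p, k)) (psi chi phi : 'M[R]_(k, q)) :
  Y *m psi - Z *m chi - ((Y - Z) *m phi + c *m (psi - chi)) =
  (Y - Z) *m (psi - phi) + (Z - c) *m (psi - chi).
Proof.
rewrite !mulmxBl !mulmxBr.
move: (Y *m psi) (Y *m phi) (Z *m psi) (Z *m phi) (Z *m chi) (c *m psi) (c *m chi).
by move=> x1 x2 x3 x4 x5 x6 x7; apply/matrixP => i j; rewrite !mxE; ring.
Qed.

Lemma factor_step (Z c D : 'M[R]_(p, k)) (chi phi G : 'M[R]_(k, q)) :
  (Z + D) *m (chi + G) - Z *m chi - (D *m phi + c *m G) =
  D *m (chi - phi) + (Z - c) *m G + D *m G.
Proof.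
rewrite !mulmxDl !mulmxDr !mulmxN !mulNmx.
move: (Z *m chi) (D *m chi) (Z *m G) (D *m G) (D *m phi) (c *m G).
by move=> x1 x2 x3 x4 x5 x6; apply/matrixP => i j; rewrite !mxE; ring.
Qed.

Lemma frob_mulmx_le (A : 'M[R]_(p, k)) (X : 'M[R]_(k, q)) (a e : R) :
  frob A <= a -> frob X <= e -> frob (A *m X) <= a * e.
Proof.
by move=> Aa Xe; apply: (le_trans (frob_mulmx _ _)); rewrite ler_pM ?frob_ge0.
Qed.

End MatrixFactorization.

Section RankManifold.
Context {R : realType}.

Context {m n : nat}.

Lemma realrep_range_subspace : lin_subspace (range (@realrep R m n)).
Proof.
split; first by exists 0 => //; exact: realrep0.
by move=> a _ _ [A _ <-] [B _ <-]; exists (qscale a A + B) => //; rewrite realrepD realrepZ.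
Qed.

Lemma pure_subspace : lin_subspace (realrep @` (@pure_mfd R m n)).
Proof.
split; first by exists 0; [apply/matrixP => i j; rewrite !mxE|exact: realrep0].
move=> a _ _ [A hA <-] [B hB <-]; exists (qscale a A + B); last by rewrite realrepD realrepZ.
apply/matrixP => i j; move/matrixP/(_ i j): hA; move/matrixP/(_ i j): hB; rewrite !mxE /=.
by move=> -> ->; rewrite mulr0 addr0.
Qed.

(** By lower semicontinuity at B a nearby limit has rank at least r; by the same at the limit, a
    larger rank would spread to the approximating matrices of rank r. *)
Lemma rank_mfd_locally_closed r (B : 'M[quat R]_(m, n)) :
  rank_mfd r B -> locally_closed (realrep @` rank_mfd r) (realrep B).
Proof.
move=> rB; have [rho rho0 hrho] := qrank_open B; exists (rho / 2); first lra.
move=> s s_rho u hu.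
have us : frob (u - realrep B) <= s.
  apply/ler_addgt0Pl => e e0; have [z [_ zs] uz] := hu e e0.
  by have := frob_triangleB u z (realrep B); lra.
have [A _ Au] : range (@realrep R m n) u.
  apply: (lin_subspace_closed realrep_range_subspace) => e e0.
  by have [_ [[Z _ <-] _] uz] := hu e e0; exists (realrep Z) => //; exists Z.
split => //; exists A => //.
have h1 : (r <= qrank A)%N by rewrite -rB; apply: hrho; rewrite Au; lra.
apply/eqP; rewrite eqn_leq h1 andbT leqNgt; apply/negP => h2.
have [rA rA0 hA] := qrank_open A.
have [_ [[Z rZ <-] _] uz] := hu rA rA0.
have := hA Z; rewrite Au frob_distC rZ => /(_ uz).
by rewrite leqNgt h2.
Qed.

(* With B = C F for the columns C of B indexed by a maximal right free set J, nearby
   rank r matrices factor through their own columns indexed by J, and the tangent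
   space at B is {D F + C G}. *)
Lemma rank_mfd_tangent_at r (B : 'M[quat R]_(m, n)) : rank_mfd r B ->
  exists P, orth_projector P /\ tangent_at (realrep @` rank_mfd r) (realrep B) P.
Proof.
move=> rB; have [J hJ rJ] := (qrank_geP B _).1 (leqnn _).
have {}rJ : qrank B = #|J| by apply/eqP; rewrite eqn_leq rJ /=; apply/qrank_geP; exists J.
have [F BF] := qrank_factor hJ rJ.
set f := @enum_val _ (mem J) in BF.
set C := colsub f B in BF.
have rk : r = #|J| by rewrite -rB.
have [H HC] : exists H, H *m realrep C = 1%:M.
  by apply/right_injective_left_inverse; exact/right_freeP.
(* [S] selects the columns J. Then phi S = 1, because C F and C have the same image under this
   selection up to the left inverse of C: c phi S = b S = c. *)
pose S := realrep (colsub f (1%:M : 'M[quat R]_n)).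
have colE k (X : 'M[quat R]_(k, n)) : realrep (colsub f X) = realrep X *m S.
  by rewrite -realrep_mul mulmx_colsub mulmx1.
have FS : realrep F *m S = 1%:M.
  by rewrite -[LHS]mul1mx -HC -mulmxA (mulmxA (realrep C)) -realrep_mul -BF -colE HC.
set b := realrep B; set c := realrep C in HC; set phi := realrep F in FS.
have bE : b = c *m phi by rewrite /b BF realrep_mul.
have cE : c = b *m S by rewrite /c colE.
pose T := [set t | exists D G, t = realrep D *m phi + c *m realrep G].
have sT : lin_subspace T.
  split; first by exists 0, 0; rewrite !realrep0 mul0mx mulmx0 addr0.
  move=> a _ _ [D [G ->]] [D' [G' ->]]; exists (qscale a D + D'), (qscale a G + G').
  by rewrite !realrepD !realrepZ mulmxDl mulmxDr -scalemxAl -scalemxAr scalerDr addrACA.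
have [P [hP TP PT]] := orth_projector_exists sT.
exists P; split => // d d0.
have [r1 r10 hfree] := right_free_open hJ.
have [r2 r20 hrank] := qrank_open B.
have [K [K1 KS KHS KK KG]] : exists K, [/\ 1 <= K, frob S <= K, 2 * (frob H * frob S) <= K,
    2 * (frob H + frob H * frob S * (frob phi + 1)) <= K &
    frob H * (1 + frob S * frob phi) <= K].
  exists (2 * (frob H + frob H * frob S * (frob phi + 1)) + frob S + 1).
  have a1 := frob_ge0 H; have a2 := frob_ge0 S; have a3 := frob_ge0 phi.
  have a4 : 0 <= frob H * frob S by rewrite mulr_ge0.
  have a5 : 0 <= frob H * frob S * frob phi by rewrite mulr_ge0.
  clear - a1 a2 a3 a4 a5; split; lra.
have K0 : 0 < K by apply: lt_le_trans K1.
have HS0 : 0 <= frob H * frob S by rewrite mulr_ge0 ?frob_ge0.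
(* In order: the Lipschitz bound on coefficients, the size of the product remainders, freeness of J
   near B, and rank at least r at the constructed point, which is within (2 + d) rho of B. *)
have [rho [rho0 rhoK rhod rho1 rho2]] : exists rho, [/\ 0 < rho, K * rho <= 1 / 2,
    3 * (K * rho) * K <= d, rho < r1 & (2 + d) * rho < r2].
  have d2 : 0 < 2 + d by clear - d0; lra.
  have K2 : 0 < 3 * K * K by rewrite !mulr_gt0.
  exists (Num.min (Num.min (1 / 2 / K) (d / (3 * K * K))) (Num.min (r1 / 2) (r2 / (2 + d) / 2))).
  set x := Num.min _ _.
  have x1 : x <= 1 / 2 / K by rewrite !ge_min lexx.
  have x2 : x <= d / (3 * K * K) by rewrite !ge_min lexx !orbT.
  have x3 : x <= r1 / 2 by rewrite !ge_min lexx !orbT.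
  have x4 : x <= r2 / (2 + d) / 2 by rewrite !ge_min lexx !orbT.
  rewrite ler_pdivlMr // in x1; rewrite ler_pdivlMr // in x2.
  rewrite -mulrAC ler_pdivlMr // in x4.
  split; first by rewrite !lt_min !divr_gt0.
  - by rewrite mulrC.
  - rewrite mulrC !mulrA in x2 *; apply: le_trans x2; rewrite le_eqVlt.
    by apply/orP; left; apply/eqP; ring.
  - by clear - x3 r10; lra.
  - by rewrite mulrC; apply: (le_lt_trans x4); clear - r20; lra.
have [fac lip] : (forall y, (realrep @` rank_mfd r) y -> frob (y - b) <= rho ->
    exists Y (psi : 'M[quat R]_(#|J|, n)), [/\ y = realrep Y,
      y = y *m S *m realrep psi, frob (realrep psi - phi) <= K * rho &
      y *m S = realrep (colsub f Y)]) /\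
  (forall y z (psi chi : 'M[R]_(#|J| + #|J| + (#|J| + #|J|), n + n + (n + n))),
    frob (y - b) <= rho -> y = y *m S *m psi -> z = z *m S *m chi ->
    frob (chi - phi) <= K * rho -> frob (psi - chi) <= K * frob (y - z)).
  have small y : frob (y - b) <= rho -> frob H * frob S * frob (y - b) <= 1 / 2.
    move=> yb; apply: (le_trans _ rhoK); rewrite ler_pM ?frob_ge0 //.
    by clear - KHS HS0; lra.
  have HbS : H *m (b *m S) = 1%:M by rewrite -cE.
  have lip y z (psi chi : 'M[R]_(#|J| + #|J| + (#|J| + #|J|), n + n + (n + n))) :
    frob (y - b) <= rho -> y = y *m S *m psi -> z = z *m S *m chi ->
    frob chi <= frob phi + 1 -> frob (psi - chi) <= K * frob (y - z).
    move=> yb ey ez hchi; apply: (le_trans (factor_lipschitz HbS ey ez (small _ yb))).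
    rewrite ler_wpM2r ?frob_ge0 //; apply: le_trans KK.
    by rewrite ler_pM2l // lerD2l ler_wpM2l.
  split.
    move=> _ [Y rY <-] hy; have hYJ := hfree Y (le_lt_trans hy rho1).
    have [psi Ypsi] := qrank_factor hYJ (etrans rY rk).
    exists Y, psi; have ey : realrep Y = realrep Y *m S *m realrep psi.
      by rewrite -colE -realrep_mul -Ypsi.
    split => //.
    have eb : b = b *m S *m phi by rewrite -cE -bE.
    have := lip _ _ _ _ hy ey eb; rewrite lerDl ler01 => /(_ isT)/le_trans; apply.
    by rewrite ler_pM2l.
  move=> y z psi chi yb ey ez hchi; apply: lip => //.
  have := frob_sub_le chi phi; clear - hchi rhoK; lra.
have KK0 : 0 <= K * rho by rewrite mulr_ge0 // ltW.
exists rho => //; split.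
  move=> y z My Mz yb zb.
  have [Y [psi [eY ey hpsi YS]]] := fac y My yb.
  have [Z [chi [eZ ez hchi ZS]]] := fac z Mz zb.
  (* The differential of the product at (c, phi) applied to the difference of the two
     factorizations. It lies in the range of P, so y - z and y - z - t have the same normal part. *)
  pose t := (y *m S - z *m S) *m phi + c *m (realrep psi - realrep chi).
  have Pt : P t = t.
    by apply: PT; exists (colsub f Y - colsub f Z), (psi - chi); rewrite !realrepB -YS -ZS.
  have -> : y - z - P (y - z) = (y - z - t) - P (y - z - t).
    by rewrite (linearB P (y - z) t) /= Pt opprB addrA subrK.
  apply: (le_trans (orth_projectorC_le _ hP)).
  have -> : y - z - t = (y - z) *m S *m (realrep psi - phi) +
      (z - b) *m S *m (realrep psi - realrep chi).
    by rewrite {1}ey {1}ez /t factor_chord cE -!mulmxBl.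
  have a1 : frob ((y - z) *m S *m (realrep psi - phi)) <= K * rho * K * frob (y - z).
    have -> : K * rho * K * frob (y - z) = frob (y - z) * K * (K * rho) by ring.
    by apply: frob_mulmx_le => //; exact: frob_mulmx_le.
  have a2 : frob ((z - b) *m S *m (realrep psi - realrep chi)) <= K * rho * K * frob (y - z).
    rewrite [K * rho]mulrC -[_ * K * frob (y - z)]mulrA.
    by apply: frob_mulmx_le; [exact: frob_mulmx_le|exact: (lip _ _ _ _ yb ey ez hchi)].
  have a3 : 3 * (K * rho) * K * frob (y - z) <= d * frob (y - z) by rewrite ler_wpM2r ?frob_ge0.
  apply: (le_trans (frob_triangle _ _)); apply: (le_trans (lerD a1 a2)).
  apply: le_trans a3; have -> : 3 * (K * rho) * K * frob (y - z) =
      K * rho * K * frob (y - z) + K * rho * K * frob (y - z) + K * rho * K * frob (y - z) by ring.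
  by rewrite lerDl !mulr_ge0 ?frob_ge0 // ltW.
move=> z t Mz zb Pt tb.
have [Z [chi [eZ ez hchi ZS]]] := fac z Mz zb.
have [D [G tDG]] : T t by rewrite -Pt.
pose s := D *m F + C *m G.
have st : realrep s = t by rewrite /s realrepD !realrep_mul tDG.
(* D and G are not determined by t. Normalising G' to vanish on the columns J makes D' the columns J
   of t, and both become bounded by K |t|. *)
pose D' := colsub f s; pose G' := G - colsub f G *m F.
have D't : realrep D' = t *m S by rewrite /D' colE st.
have tE : t = realrep D' *m phi + c *m realrep G'.
  rewrite D't tDG realrepB realrep_mul colE mulmxDl mulmxBr mulmxDl.
  rewrite -(mulmxA _ phi) FS mulmx1 !mulmxA.
  by apply/matrixP => i j; rewrite !mxE; ring.
have G't : realrep G' = H *m (t - t *m S *m phi).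
  by rewrite -D't {1}tE [_ + c *m _]addrC addrK mulmxA HC mul1mx.
have t0 := frob_ge0 t.
have nD : frob (realrep D') <= frob t * K by rewrite D't; exact: frob_mulmx_le.
have nG : frob (realrep G') <= K * frob t.
  rewrite G't; apply: (le_trans (frob_mulmx _ _)).
  have : frob H * (1 + frob S * frob phi) * frob t <= K * frob t by rewrite ler_wpM2r.
  apply: le_trans; rewrite -mulrA ler_wpM2l ?frob_ge0 //.
  apply: (le_trans (frob_triangle _ _)); rewrite frobN mulrDl mul1r lerD2l.
  rewrite mulrC mulrA.
  by do 2!(apply: (le_trans (frob_mulmx _ _)); rewrite ?ler_wpM2r ?frob_ge0 //).
pose y := realrep ((colsub f Z + D') *m (chi + G')).
have yE : y - z - t = realrep D' *m (realrep chi - phi) + (z - b) *m S *m realrep G' +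
    realrep D' *m realrep G'.
  by rewrite /y realrep_mul (realrepD _ D') (realrepD chi) -ZS {2}ez {1}tE factor_step cE -mulmxBl.
have ny : frob (y - z - t) <= 3 * (K * rho) * K * frob t.
  have a1 : frob (realrep D' *m (realrep chi - phi)) <= K * rho * K * frob t.
    have -> : K * rho * K * frob t = frob t * K * (K * rho) by ring.
    exact: frob_mulmx_le.
  have a2 : frob ((z - b) *m S *m realrep G') <= K * rho * K * frob t.
    rewrite [K * rho]mulrC -[_ * K * frob t]mulrA.
    by apply: frob_mulmx_le => //; exact: frob_mulmx_le.
  have a3 : frob (realrep D' *m realrep G') <= K * rho * K * frob t.
    have -> : K * rho * K * frob t = frob t * K * (K * rho) by ring.
    by apply: frob_mulmx_le => //; apply: (le_trans nG); rewrite ler_pM2l.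
  rewrite yE; have -> : 3 * (K * rho) * K * frob t =
      K * rho * K * frob t + K * rho * K * frob t + K * rho * K * frob t by ring.
  apply: (le_trans (frob_triangle _ _)); apply: lerD => //.
  by apply: (le_trans (frob_triangle _ _)); exact: lerD.
have ndt : frob (y - z - t) <= d * frob t.
  by apply: (le_trans ny); rewrite ler_wpM2r.
exists y => //; exists ((colsub f Z + D') *m (chi + G')) => //.
(* Rank at most r by the factorization, at least r by closeness to B. *)
apply/eqP; rewrite eqn_leq {1}rk qrank_mul_le /= -rB; apply: hrank; rewrite -/y -/b.
have a1 := frob_sub_le (y - z) t; have a2 := frob_triangleB y z b.
have a3 : d * frob t <= d * rho by rewrite ler_pM2l.
move: a1 a2 a3 ndt zb tb rho2; clear.
move: (frob (y - b)) (frob (y - z)) (frob (y - z - t)) (frob (z - b)) (frob t).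
by move=> x1 x2 x3 x4 x5; lra.
Qed.

End RankManifold.

(** * Transfer to quaternion matrices and conclusion *)

Lemma closest_realrep {R : realType} {m n : nat} (N : set 'M[quat R]_(m, n)) X Y :
  closest N X Y <-> frob_closest (realrep @` N) (realrep X) (realrep Y).
Proof.
have e (U V : 'M[quat R]_(m, n)) : frob (realrep U - realrep V) = 2 * qnorm (U - V).
  by rewrite -realrepB frob_realrep.
split=> [[NY h]|[[Y' NY' /realrep_inj <-] h]]; split => //.
- by move=> _ [Z NZ <-]; rewrite !e ler_pM2l // h.
- move=> Z NZ; have := h (realrep Z) (ex_intro2 _ _ Z NZ erefl).
  by rewrite !e ler_pM2l.
Qed.

Lemma closest_exists_realrep {R : realType} {m n : nat} (N : set 'M[quat R]_(m, n)) X :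
  (exists Y, frob_closest (realrep @` N) (realrep X) Y) -> exists Y, closest N X Y.
Proof.
by move=> [_ [[Y NY <-] h]]; exists Y; apply/closest_realrep; split => //; exists Y.
Qed.

Unset Implicit Arguments.
Set Strict Implicit.
Set Printing Implicit Defensive.

Theorem theorem3p1 (R : realType) (m n r : nat)
    (hm : (0 < m)%N) (hn : (0 < n)%N) (hr : (0 < r)%N) (hrmn : (r <= minn m n)%N)
    (pr1 pr2 pr : 'M[quat R]_(m, n) -> 'M[quat R]_(m, n))
    (hpr1 : is_projection (rank_mfd r) pr1)
    (hpr2 : is_projection pure_mfd pr2)
    (hpr : is_projection (pure_rank_mfd r) pr)
    (B : 'M[quat R]_(m, n)) (hB : pure_rank_mfd r B)
    (hnt : nontangential (realrep @` rank_mfd r) (realrep @` pure_mfd) (realrep B))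
    (eps c : R) (heps : 0 < eps)
    (hc : sigma (realrep @` rank_mfd r) (realrep @` pure_mfd) (realrep B) < c)
    (hc1 : c < 1) :
  exists s C : R, 0 < s /\
    forall A : 'M[quat R]_(m, n), qnorm (A - B) < s ->
    forall X Y : nat -> 'M[quat R]_(m, n),
      X 0%N = A ->
      (forall k, Y k.+1 = pr1 (X k)) ->
      (forall k, X k.+1 = pr2 (Y k.+1)) ->
      exists Xoo : 'M[quat R]_(m, n),
        [/\ (qnorm (X k - Xoo) @[k --> \oo] --> (0 : R)),
            pure_rank_mfd r Xoo,
            qnorm (Xoo - pr A) <= eps * qnorm (A - pr A) &
            forall k, qnorm (Xoo - X k) <= C * c ^+ k * qnorm (A - pr A)].
Proof.
pose M1 := realrep @` @rank_mfd R m n r; pose L := realrep @` @pure_mfd R m n.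
pose b := realrep B.
have hM : realrep @` @pure_rank_mfd R m n r = M1 `&` L.
  apply/seteqP; split=> [_ [Z [h1 h2] <-]|_ [[Z h1 <-] [Z' h2 /realrep_inj e]]].
    by split; exists Z.
  by exists Z => //; split => //; rewrite -e.
have [[Mb [d [U [f [x hchart]]]] hne] _] := hnt; rewrite -/M1 -/L -/b in Mb hne hc.
have [P1 [oP1 tP1]] := rank_mfd_tangent_at hB.1.
have cM1 := rank_mfd_locally_closed hB.1.
have [PL [oPL LPL PLL]] := orth_projector_exists (@pure_subspace R m n).
have hL u : L u <-> PL u = u by split=> [|<-]; [exact: PLL|exact: LPL].
have [P [oP tP hP _]] := chart_tangent_at hchart.
(* Used with M1, L and their intersection: the first two place the range of P inside those of P1 and
   PL, the third places the tangent vectors of every chart in the range of P. *)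
have hT M' Q : M1 `&` L `<=` M' -> orth_projector Q -> tangent_at M' b Q ->
    forall w, tangent_space (M1 `&` L) b w -> Q w = w.
  by move=> MM' oQ tQ w; apply: (tangent_space_projector MM' (MM' _ Mb) oQ tQ).
have rangeP u : tangent_space (M1 `&` L) b (P u) by exists d, U, f, x; split.
have tPL := lin_subspace_tangent_at (@pure_subspace R m n) Mb.2 hL.
have PP1 : forall u, P (P1 u) = P u.
  apply: orth_projector_absorbV => // u.
  by apply: (hT M1 P1) => //; exact: subIsetl.
have PPL : forall u, P (PL u) = P u.
  apply: orth_projector_absorbV => // u.
  by apply: (hT L PL) => //; exact: subIsetr.
have TP := hT _ P (@subset_refl _ _) oP tP.
have [k /andP[k0 kc] hk] := sigma_lt_angle Mb.1 (@pure_subspace R m n) Mb.2 oP1 oP tP1 cM1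
  PP1 TP hne hc.
have angle u v : P1 u = u -> P u = 0 -> PL v = v -> P v = 0 ->
    frob_dot u v <= k * (frob u * frob v).
  by move=> hu Pu /hL Lv Pv; exact: hk.
have [s1 s10 hs1] := alternating_projections Mb oP1 oPL oP hL PP1 PPL tP1 tP cM1
  k0 kc hc1 angle heps.
have [s2 s20 hs2] := frob_closest_exists Mb (locally_closedI hL cM1).
(* The halves compensate [frob (realrep A) = 2 * qnorm A]. *)
exists (Num.min (s1 / 2) (s2 / 2)), (2 / (1 - c)); split.
  by rewrite lt_min !divr_gt0.
move=> A; rewrite lt_min => /andP[A1 A2] X Y X0 hY hX.
have AB : frob (realrep A - b) = 2 * qnorm (A - B) by rewrite -realrepB frob_realrep.
have cA : closest (pure_rank_mfd r) A (pr A).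
  apply: hpr; apply: closest_exists_realrep; rewrite hM; apply: hs2.
  by rewrite -/b AB; lra.
have [|||||Xoo [MXoo hXeps hXk]] := hs1 (realrep A) (realrep (pr A)) _ _
  (fun k => realrep (X k)) (fun k => realrep (Y k)).
- by rewrite AB; lra.
- by rewrite -hM; apply/closest_realrep.
- by rewrite X0.
- move=> j /closest_exists_realrep /hpr1 h; rewrite hY.
  exact/closest_realrep.
(* Closest points of L are unique, so [pr2] acts as [PL]. *)
- move=> j; have [hcl huniq] := frob_closest_projector (realrep (Y j.+1)) oPL hL.
  apply: huniq; apply/closest_realrep; rewrite hX; apply: hpr2.
  by apply: closest_exists_realrep; exists (PL (realrep (Y j.+1))).
move: MXoo; rewrite -hM => -[Z MZ ZX]; rewrite -ZX in hXeps hXk.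
have q2 (V W : 'M[quat R]_(m, n)) : frob (realrep V - realrep W) = 2 * qnorm (V - W).
  by rewrite -realrepB frob_realrep.
have bound j : qnorm (Z - X j) <= 2 / (1 - c) * c ^+ j * qnorm (A - pr A).
  by have := hXk j; rewrite !q2 mulrCA ler_pM2l.
exists Z; split => //.
  have c0 : 0 < c by exact: le_lt_trans kc.
  apply: (@squeeze_cvgr _ _ _ _ (fun=> 0) (fun j => 2 / (1 - c) * c ^+ j * qnorm (A - pr A))).
  - apply: nearW => j; rewrite sqrtr_ge0 /=; apply: le_trans (bound j).
    by rewrite -(ler_pM2l (ltr0n R 2)) -!q2 frob_distC.
  - exact: cvg_cst.
  - rewrite -(mul0r (qnorm (A - pr A))); apply: cvgM; last exact: cvg_cst.
    rewrite -(mulr0 (2 / (1 - c))); apply: cvgM; first exact: cvg_cst.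
    by apply: cvg_expr; rewrite ger0_norm // ltW.
by move: hXeps; rewrite !q2 mulrCA ler_pM2l.
Qed.
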